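(* Let $\underline{C}=(C_1,\dots,C_d)$ be a row contraction on a Hilbert space $\mathcal{H}_C$. Let $M_\theta:\Gamma\otimes\mathcal{D}\to\Gamma\otimes\mathcal{D}_C$ and $M_{\hat\theta}:\Gamma\otimes\mathcal{M}\to\Gamma\otimes\mathcal{D}_C$ be two contractive multi-analytic operators with injective symbols $\theta,\hat\theta$. Let $$\underline{E}=\begin{bmatrix} \underline{C} & 0 \\ \underline{B} & \underline{A} \end{bmatrix}\ \text{on}\ \mathcal{H}_C\oplus\mathcal{H}_A,\qquad \underline{\hat E}=\begin{bmatrix} \underline{C} & 0 \\ \underline{\hat B} & \underline{\hat A} \end{bmatrix}\ \text{on}\ \mathcal{H}_C\oplus\mathcal{H}_{\hat A}$$ be the minimal contractive liftings of $\underline{C}$ associated to $M_\theta$ and $M_{\hat\theta}$ respectively, and let $\gamma:\mathcal{D}_{*,A}\to\mathcal{D}_C$ and $\hat\gamma:\mathcal{D}_{*,\hat A}\to\mathcal{D}_C$ be the contractions with $\underline{B}^*=D_C\gamma D_{*,A}$ and $\underline{\hat B}^*=D_C\hat\gamma D_{*,\hat A}$. Then the symbols $\theta$ and $\hat\theta$ are equivalent if and only if there exist unitary operators $U:\mathcal{D}_{\hat A}\to\mathcal{D}_A$ and $\tilde U:\mathcal{D}_{*,\hat A}\to\mathcal{D}_{*,A}$ such that $$\gamma=\hat\gamma\tilde U^*,\qquad \theta_AU=(I_\Gamma\otimes\tilde U)\theta_{\hat A}.$$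
   Context: A tuple $\underline{T}=(T_1,\ldots,T_d)$ of bounded operators on a Hilbert space $\mathcal{H}$ is a row contraction if $\sum_{i=1}^d T_iT_i^*\le I$; we view $\underline{T}=[T_1\ \cdots\ T_d]:\bigoplus_{i=1}^d\mathcal{H}\to\mathcal{H}$. Defect operators and spaces: $D_T=(I-\underline{T}^*\underline{T})^{1/2}$ on $\bigoplus_{i=1}^d\mathcal{H}$, $D_{*,T}=(I-\underline{T}\,\underline{T}^* )^{1/2}$ on $\mathcal{H}$, $\mathcal{D}_T=\overline{\mathrm{ran}}\,D_T$, $\mathcal{D}_{*,T}=\overline{\mathrm{ran}}\,D_{*,T}$. $\tilde\Lambda$ is the set of all finite words $\alpha=(\alpha_1,\ldots,\alpha_n)$ in $\{1,\ldots,d\}$ (including the empty word), $|\alpha|=n$, $T_\alpha=T_{\alpha_1}\cdots T_{\alpha_n}$ ($T_\emptyset=I$). $\Gamma$ is the full Fock space over $\mathbb{C}^d$ with vacuum vector $e_0$; $e_\alpha=e_{\alpha_1}\otimes\cdots\otimes e_{\alpha_n}$ ($e_\emptyset=e_0$); $L_ix=e_i\otimes x$ are the left creation operators. $\iota_j$ is the inclusion $\mathcal{H}\to\bigoplus_{i=1}^d\mathcal{H}$ as $j$-th component, $P_k$ the $k$-th coordinate projection. A bounded operator $M:\Gamma\otimes\mathcal{H}_1\to\Gamma\otimes\mathcal{H}_2$ is multi-analytic if $M(L_i\otimes I)=(L_i\otimes I)M$ for all $i$; its symbol is $\theta=M|_{e_0\otimes\mathcal{H}_1}:\mathcal{H}_1\to\Gamma\otimes\mathcal{H}_2$,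 and $M=M_\theta$. Symbols $\theta_1:\mathcal{H}_1\to\Gamma\otimes\mathcal{H}$, $\theta_2:\mathcal{H}_2\to\Gamma\otimes\mathcal{H}$ are equivalent if there is a unitary $v:\mathcal{H}_1\to\mathcal{H}_2$ with $\theta_1=\theta_2v$. A row contraction $\underline{E}$ on $\mathcal{H}_C\oplus\mathcal{H}_A$ is a contractive lifting of $\underline{C}$ by $\underline{A}$ if $E_i=\begin{bmatrix} C_i & 0 \\ B_i & A_i \end{bmatrix}$ for all $i$; it is minimal if $\mathcal{H}_C\oplus\mathcal{H}_A=\overline{\mathrm{span}}\{E_\alpha x:x\in\mathcal{H}_C,\alpha\in\tilde\Lambda\}$. For a contractive lifting there is a unique contraction $\gamma:\mathcal{D}_{*,A}\to\mathcal{D}_C$ with $\underline{B}^*=D_C\gamma D_{*,A}$. The characteristic function (symbol) of $\underline{A}$ is $\theta_A:\mathcal{D}_A\to\Gamma\otimes\mathcal{D}_{*,A}$, $\theta_Ax=-e_0\otimes\underline{A}x+\sum_{k=1}^d\sum_{\alpha}e_k\otimes e_\alpha\otimes D_{*,A}A_\alpha^*P_kD_Ax$ (and similarly for $\underline{\hat A}$). Lifting associated to $M_\theta$: Let $V_i^C$ be the minimal isometric dilation of $\underline{C}$ on $\mathcal{H}_C\oplus(\Gamma\otimes\mathcal{D}_C)$, $V_i^C(h\oplus\xi)=C_ih\oplus\bigl(e_0\otimes D_C\iota_i(h)+(L_i\otimes I)\xi\bigr)$. Put $\Delta_\theta=(I-M_\theta^*M_\theta)^{1/2}$ and let $Y_i$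 be the isometry on $\overline{\Delta_\theta(\Gamma\otimes\mathcal{D})}$ with $Y_i\Delta_\theta f=\Delta_\theta(L_i\otimes I)f$. Let $$\mathcal{H}_A=\bigl[(\Gamma\otimes\mathcal{D}_C)\oplus\overline{\Delta_\theta(\Gamma\otimes\mathcal{D})}\bigr]\ominus\{M_\theta f\oplus\Delta_\theta f:f\in\Gamma\otimes\mathcal{D}\}.$$ Then $\mathcal{H}_C\oplus\mathcal{H}_A$ is invariant under all $(V_i^C\oplus Y_i)^*$, and $\underline{E}$ is defined by $E_i^*=(V_i^C\oplus Y_i)^*|_{\mathcal{H}_C\oplus\mathcal{H}_A}$. It is known (prior work) that when $\theta$ is injective, $\underline{E}$ is a minimal contractive lifting of $\underline{C}$ and $\theta$ is equivalent to the characteristic function (symbol) $\theta_{C,E}:\mathcal{D}_E\to\Gamma\otimes\mathcal{D}_C$ of this lifting, where $\theta_{C,E}D_E\iota_j(h_c)=e_0\otimes(D_C\iota_j(h_c)-\gamma D_{*,A}B_jh_c)-\sum_{|\alpha|\ge1}e_\alpha\otimes\gamma D_{*,A}A_\alpha^*B_jh_c$ for $h_c\in\mathcal{H}_C$ and $\theta_{C,E}D_E\iota_j(h_a)=(I_\Gamma\otimes\gamma)\theta_AD_A\iota_j(h_a)$ for $h_a\in\mathcal{H}_A$. *)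

(* Defs.v *)
From HB Require Import structures.
From mathcomp Require Import all_boot all_order all_algebra.
From mathcomp Require Import complex.
From mathcomp Require Import all_classical all_reals.
From mathcomp Require Import topology normedtype sequences.
From mathcomp Require Import ring lra.

Set Implicit Arguments.
Unset Strict Implicit.
Unset Printing Implicit Defensive.

Import Order.TTheory GRing.Theory Num.Theory.
Import numFieldNormedType.Exports.

Local Open Scope classical_set_scope.
Local Open Scope ring_scope.

Section InnerProductNorm.
Variables (R : realType) (V : lmodType R[i]) (ip : V -> V -> R[i]).
Hypothesis ipDl : forall x y z : V, ip (x + y) z = ip x z + ip y z.
Hypothesis ipZl : forall (a : R[i]) (x y : V), ip (a *: x) y = a * ip x y.
Hypothesis ipC : forall x y : V, ip x y = (ip y x)^*.
Hypothesis ip_ge0 : forall x : V, 0 <= ip x x.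
Hypothesis ip_eq0 : forall x : V, ip x x = 0 -> x = 0.

Let ipDr x y z : ip x (y + z) = ip x y + ip x z.
Proof. by rewrite ipC ipDl rmorphD/= -!ipC. Qed.

Let ipZr a x y : ip x (a *: y) = a^* * ip x y.
Proof. by rewrite ipC ipZl rmorphM/= -ipC. Qed.

Let nrm (x : V) : R[i] := sqrtC (ip x x).

Let nrm_ge0 x : 0 <= nrm x.
Proof. by rewrite sqrtC_ge0 ip_ge0. Qed.

Let sqr_nrm x : nrm x ^+ 2 = ip x x.
Proof. exact: sqrtCK. Qed.

Lemma ip_nrmZ a x : nrm (a *: x) = `|a| * nrm x.
Proof.
rewrite /nrm ipZl ipZr mulrA -normCK rootCMl ?exprn_ge0//.
by rewrite sqrCK.
Qed.

Lemma ip_nrm0_eq0 x : nrm x = 0 -> x = 0.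
Proof. by move=> /eqP; rewrite sqrtC_eq0 => /eqP /ip_eq0. Qed.

Lemma ip_cauchy_schwarz x y : `|ip x y| <= nrm x * nrm y.
Proof.
have [y0|y0] := eqVneq (ip y y) 0.
  rewrite (ip_eq0 y0) -(scale0r x) ipZr conjC0 mul0r normr0.
  by rewrite mulr_ge0.
have yy0 : 0 < ip y y by rewrite lt_def y0 ip_ge0.
rewrite -(@ler_pXn2r _ 2) ?nnegrE ?mulr_ge0// exprMn !sqr_nrm.
pose a := ip x y / ip y y.
have yyr : (ip y y)^* = ip y y by rewrite -ipC.
have aE : a^* = ip y x / ip y y by rewrite /a rmorphM fmorphV/= -!ipC.
have := ip_ge0 (x + (- a) *: y).
rewrite ipDl !ipDr !ipZl !ipZr rmorphN/= aE.
have -> : - a * (- (ip y x / ip y y) * ip y y) = a * ip y x.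
  by rewrite [in LHS]mulNr [in LHS]mulNr mulrN opprK divfK.
rewrite [- a * _]mulNr addNr addr0.
rewrite mulNr subr_ge0 mulrAC ler_pdivrMr// => h.
by rewrite normCK -ipC mulrC.
Qed.

Lemma ip_ler_nrmD x y : nrm (x + y) <= nrm x + nrm y.
Proof.
rewrite -(@ler_pXn2r _ 2) ?nnegrE ?addr_ge0// sqrrD !sqr_nrm.
rewrite ipDl !ipDr addrA lerD2r -addrA lerD2l.
have xyr : ip x y + ip y x \is Num.real.
  by rewrite CrealE rmorphD/= -!ipC addrC.
rewrite (le_trans (real_ler_norm xyr))// (le_trans (ler_normD _ _))//.
rewrite mulr2n lerD ?ip_cauchy_schwarz// mulrC.
exact: ip_cauchy_schwarz.
Qed.

End InnerProductNorm.

Section SequentialCompleteness.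
Variable (R : realType).

Lemma complex_archi (e : R[i]) : 0 < e -> exists n, n.+1%:R^-1 < e.
Proof.
case: e => a b; rewrite ltcE/= => /andP[/eqP -> a0].
exists (Num.truncn a^-1).
have -> : (Num.truncn a^-1).+1%:R^-1 =
    ((Num.truncn a^-1).+1%:R^-1)%:C%C :> R[i].
  by rewrite fmorphV/= rmorph_nat.
by rewrite ltcR invf_plt ?posrE// truncnS_gt.
Qed.

Lemma cauchy_seq_complete (V : normedModType R[i]) :
  (forall u : nat -> V,
    (forall e : R[i], 0 < e -> exists N, forall m n, (N <= m)%N -> (N <= n)%N ->
       `|u m - u n| < e) ->
    exists l, forall e : R[i], 0 < e -> exists N, forall n, (N <= n)%N ->
       `|u n - l| < e) ->
  forall F : set_system V, ProperFilter F -> cauchy F -> cvg F.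
Proof.
move=> scpl F FF /(@cauchyP _ V) Fc.
have /choice[u uF] : forall n, exists x, F (ball x (n.+1%:R^-1 : R[i])).
  by move=> n; apply: Fc; rewrite invr_gt0 ltr0n.
have small n N : (N <= n)%N -> n.+1%:R^-1 <= N.+1%:R^-1 :> R[i].
  by move=> Nn; rewrite lef_pV2 ?posrE ?ltr0n// ler_nat.
have [|l ul] := scpl u.
  move=> e e0; have e20 : 0 < e / 2 by rewrite divr_gt0.
  have [N Ne] := complex_archi e20; exists N => m n Nm Nn.
  have [z [zm zn]] := filter_ex (filterI (uF m) (uF n)).
  rewrite -(subrK z (u m)) -addrA (le_lt_trans (ler_normD _ _))//.
  rewrite (splitr e) ltrD//.
    move: zm; rewrite -ball_normE/= => /lt_le_trans -> //.
    by rewrite (le_trans (small _ _ Nm))// ltW.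
  move: zn; rewrite -ball_normE/= distrC => /lt_le_trans -> //.
  by rewrite (le_trans (small _ _ Nn))// ltW.
apply/cvg_ex; exists l; apply/cvg_ballP => e e0.
have e20 : 0 < e / 2 by rewrite divr_gt0.
have [N Ne] := complex_archi e20; have [N' N'e] := ul _ e20.
pose n := maxn N N'.
have := uF n; apply: filterS => y.
rewrite -!ball_normE/= => uny.
rewrite -(subrK (u n) l) -addrA (le_lt_trans (ler_normD _ _))//.
rewrite (splitr e) ltrD//; first by rewrite distrC N'e// leq_maxr.
by rewrite (lt_trans uny)// (le_lt_trans _ Ne)// small// leq_maxl.
Qed.

Lemma cauchy_seq_cvg (V : completeNormedModType R[i]) (u : nat -> V) :
  (forall e : R[i], 0 < e -> exists N, forall m n, (N <= m)%N -> (N <= n)%N ->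
     `|u m - u n| < e) ->
  exists l, forall e : R[i], 0 < e -> exists N, forall n, (N <= n)%N ->
     `|u n - l| < e.
Proof.
move=> uc; have /cvg_ex[l ul] : cvg (u @ \oo).
  apply: cauchy_cvg; apply: (@cauchy_exP _ V) => e e0.
  have [N Ne] := uc _ e0; exists (u N); exists N => // n/= Nn.
  by rewrite -ball_normE/=; exact: Ne.
exists l => e e0; move/cvg_ballP: ul => /(_ _ e0)[N _ Nu].
by exists N => n Nn; have := Nu n Nn; rewrite /= -ball_normE/= distrC.
Qed.

End SequentialCompleteness.

HB.mixin Record CompleteNormed_isHilbert (R : realType) V
    & CompleteNormedModule R[i] V := {
  inner : V -> V -> R[i] ;
  innerDl : forall x y z : V, inner (x + y) z = inner x z + inner y z ;
  innerZl : forall (a : R[i]) (x y : V), inner (a *: x) y = a * inner x y ;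
  innerC : forall x y : V, inner x y = (inner y x)^* ;
  inner_norm : forall x : V, inner x x = `|x| ^+ 2
}.

#[short(type="hilbertType")]
HB.structure Definition Hilbert (R : realType) :=
  {V of CompleteNormedModule R[i] V & CompleteNormed_isHilbert R V}.

HB.factory Record Lmodule_isHilbert (R : realType) V
    & GRing.Lmodule R[i] V := {
  inner : V -> V -> R[i] ;
  innerDl : forall x y z : V, inner (x + y) z = inner x z + inner y z ;
  innerZl : forall (a : R[i]) (x y : V), inner (a *: x) y = a * inner x y ;
  innerC : forall x y : V, inner x y = (inner y x)^* ;
  inner_ge0 : forall x : V, 0 <= inner x x ;
  inner_eq0 : forall x : V, inner x x = 0 -> x = 0 ;
  inner_complete : forall u : nat -> V,
    (forall e : R[i], 0 < e -> exists N, forall m n, (N <= m)%N -> (N <= n)%N ->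
       inner (u m - u n) (u m - u n) < e) ->
    exists l, forall e : R[i], 0 < e -> exists N, forall n, (N <= n)%N ->
       inner (u n - l) (u n - l) < e
}.

HB.builders Context R V & Lmodule_isHilbert R V.

HB.instance Definition _ := @Lmodule_isNormed.Build R[i] V
  (fun x => sqrtC (inner x x)) (ip_ler_nrmD innerDl innerZl innerC inner_ge0 inner_eq0)
  (ip_nrmZ innerZl innerC) (ip_nrm0_eq0 inner_eq0).

Let inner_norm (x : V) : inner x x = `|x| ^+ 2.
Proof. by rewrite sqrtCK. Qed.

Let complete (F : set_system V) : ProperFilter F -> cauchy F -> cvg F.
Proof.
apply: (@cauchy_seq_complete R V) => u uc.
have [e e0|l ul] := inner_complete (u := u).
  have [|N Ne] := uc (sqrtC e); first by rewrite sqrtC_gt0.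
  exists N => m n Nm Nn; rewrite inner_norm -[ltRHS]sqrtCK.
  by rewrite ltr_pXn2r ?nnegrE ?Ne// sqrtC_ge0 ltW.
exists l => e e0; have [|N Ne] := ul (e ^+ 2); first by rewrite exprn_gt0.
exists N => n Nn; rewrite -(@ltr_pXn2r _ 2) ?nnegrE ?(ltW e0)//.
by rewrite -inner_norm Ne.
Qed.

HB.instance Definition _ := Uniform_isComplete.Build V complete.

HB.instance Definition _ :=
  CompleteNormed_isHilbert.Build R V innerDl innerZl innerC inner_norm.

HB.end.

Section HilbertTheory.
Variables (R : realType) (H : hilbertType R).
Implicit Types x y z : H.

Lemma innerDr x y z : inner x (y + z) = inner x y + inner x z.
Proof. by rewrite innerC innerDl rmorphD/= -!innerC. Qed.

Lemma innerZr (a : R[i]) x y : inner x (a *: y) = a^* * inner x y.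
Proof. by rewrite innerC innerZl rmorphM/= -innerC. Qed.

Lemma inner0l x : inner 0 x = 0.
Proof. by rewrite -(scale0r x) innerZl mul0r. Qed.

Lemma inner0r x : inner x 0 = 0.
Proof. by rewrite innerC inner0l conjC0. Qed.

Lemma inner_ge0 x : 0 <= inner x x.
Proof. by rewrite inner_norm exprn_ge0. Qed.

Lemma inner_eq0 x : inner x x = 0 -> x = 0.
Proof. by move=> /eqP; rewrite inner_norm sqrf_eq0 normr_eq0 => /eqP. Qed.

Lemma inner_sqrtC x : `|x| = sqrtC (inner x x).
Proof. by rewrite inner_norm sqrCK. Qed.

Lemma cauchy_schwarz x y : `|inner x y| <= `|x| * `|y|.
Proof.
rewrite !inner_sqrtC; apply: ip_cauchy_schwarz.
- exact: innerDl.
- exact: innerZl.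
- exact: innerC.
- exact: inner_ge0.
- exact: inner_eq0.
Qed.

Lemma inner_complete (u : nat -> H) :
  (forall e : R[i], 0 < e -> exists N, forall m n, (N <= m)%N -> (N <= n)%N ->
     inner (u m - u n) (u m - u n) < e) ->
  exists l, forall e : R[i], 0 < e -> exists N, forall n, (N <= n)%N ->
     inner (u n - l) (u n - l) < e.
Proof.
move=> uc; have [e e0|l ul] := @cauchy_seq_cvg R H u.
  have [|N Ne] := uc (e ^+ 2); first by rewrite exprn_gt0.
  exists N => m n Nm Nn; rewrite -(@ltr_pXn2r _ 2) ?nnegrE ?(ltW e0)//.
  by rewrite -inner_norm Ne.
exists l => e e0; have [|N Ne] := ul (sqrtC e); first by rewrite sqrtC_gt0.
exists N => n Nn; rewrite inner_norm -[ltRHS]sqrtCK.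
by rewrite ltr_pXn2r ?nnegrE ?Ne// sqrtC_ge0 ltW.
Qed.

End HilbertTheory.

HB.mixin Record isBoundedOp (R : realType) (H K : hilbertType R)
    (f : H -> K) := {
  op_bounded : exists M : R[i], forall x, `|f x| <= M * `|x|
}.

#[short(type="boundedOp")]
HB.structure Definition BoundedOp (R : realType) (H K : hilbertType R) :=
  {f of @GRing.Linear R[i] H K *:%R f & @isBoundedOp R H K f}.

Notation "''B' ( H , K )" := (boundedOp H K)
  (at level 8, format "''B' ( H ,  K )") : type_scope.

HB.instance Definition _ (R : realType) (H K : hilbertType R) :=
  gen_eqMixin 'B(H, K).
HB.instance Definition _ (R : realType) (H K : hilbertType R) :=
  gen_choiceMixin 'B(H, K).

Lemma op_boundedE (R : realType) (H K : hilbertType R) (f : 'B(H, K)) :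
  exists2 M : R[i], 0 <= M & forall x, `|f x| <= M * `|x|.
Proof.
have [M fM] := @op_bounded _ _ _ f; exists `|M| => // x.
have [->|x0] := eqVneq x 0; first by rewrite linear0 !normr0 mulr0.
have M0 : 0 <= M.
  rewrite (@le_trans _ _ (`|f x| / `|x|)) ?divr_ge0//.
  by rewrite ler_pdivrMr ?normr_gt0.
by rewrite (ger0_norm M0).
Qed.

Section BoundedOps.
Variables (R : realType) (H K L : hilbertType R).

Lemma op0_bounded :
  exists M : R[i], forall x, `|(\0 : H -> K) x| <= M * `|x|.
Proof. by exists 0 => x; rewrite normr0 mul0r. Qed.
HB.instance Definition _ := isBoundedOp.Build R H K \0 op0_bounded.

Lemma id_bounded : exists M : R[i], forall x : H, `|idfun x| <= M * `|x|.
Proof. by exists 1 => x; rewrite mul1r. Qed.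
HB.instance Definition _ := isBoundedOp.Build R H H idfun id_bounded.

Lemma comp_bounded (g : 'B(K, L)) (f : 'B(H, K)) :
  exists M : R[i], forall x, `|(g \o f) x| <= M * `|x|.
Proof.
have [M M0 fM] := op_boundedE f; have [N N0 gN] := op_boundedE g.
exists (N * M) => x; rewrite (le_trans (gN _))// -mulrA.
by rewrite ler_wpM2l.
Qed.
HB.instance Definition _ (g : 'B(K, L)) (f : 'B(H, K)) :=
  isBoundedOp.Build R H L (g \o f) (comp_bounded g f).

Lemma sub_bounded (f g : 'B(H, K)) :
  exists M : R[i], forall x, `|(f \- g) x| <= M * `|x|.
Proof.
have [M _ fM] := op_boundedE f; have [N _ gN] := op_boundedE g.
exists (M + N) => x; rewrite (le_trans (ler_normB _ _))// mulrDl.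
by rewrite lerD.
Qed.
HB.instance Definition _ (f g : 'B(H, K)) :=
  isBoundedOp.Build R H K (f \- g) (sub_bounded f g).

End BoundedOps.

Record closedSubspace (R : realType) (H : hilbertType R) := ClosedSubspace {
  csub_set :> set H ;
  csub0 : csub_set 0 ;
  csubP : forall (a : R[i]) x y,
    csub_set x -> csub_set y -> csub_set (a *: x + y) ;
  csub_closed : closed csub_set
}.

Section ClosedSubspaces.
Variables (R : realType) (H : hilbertType R).

Lemma closure_normP (A : set H) (x : H) :
  closure A x <-> forall e : R[i], 0 < e -> exists2 y, A y & `|x - y| < e.
Proof.
split=> [Ax e e0|Ax B /nbhs_ballP[e /= e0 eB]].
  have [y [Ay]] := Ax _ (nbhsx_ballx x e e0).
  by rewrite -ball_normE/=; exists y.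
have [y Ay xy] := Ax _ e0; exists y; split => //; apply: eB.
by rewrite -ball_normE.
Qed.

Definition csub_mem (S : closedSubspace H) : {pred H} :=
  [pred x | x \in (S : set H)].

Lemma csub_memP (S : closedSubspace H) x :
  reflect (csub_set S x) (x \in csub_mem S).
Proof. by apply: (iffP idP) => [/set_mem|/mem_set]. Qed.

Lemma csub_mem_submod (S : closedSubspace H) :
  GRing.subsemimod_closed (csub_mem S).
Proof.
split; [split|]; first exact/csub_memP/csub0.
  move=> x y /csub_memP Sx /csub_memP Sy; apply/csub_memP.
  by rewrite -(scale1r x); exact: csubP.
move=> a x /csub_memP Sx; apply/csub_memP.
by rewrite -[_ *: _]addr0; apply: csubP => //; exact: csub0.
Qed.
HB.instance Definition _ (S : closedSubspace H) :=
  GRing.isSubmodClosed.Build R[i] H (csub_mem S) (csub_mem_submod S).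

End ClosedSubspaces.

Section SubspaceHilbert.
Variables (R : realType) (H : hilbertType R) (S : closedSubspace H).

Definition subHilbert : Type := {x : H | x \in csub_mem S}.

HB.instance Definition _ := SubType.on subHilbert.
HB.instance Definition _ := Choice.on subHilbert.
HB.instance Definition _ := [SubChoice_isSubLmodule of subHilbert by <:].

Let sinner (x y : subHilbert) : R[i] := inner (val x) (val y).

Lemma sinnerDl (x y z : subHilbert) : sinner (x + y) z = sinner x z + sinner y z.
Proof. by rewrite /sinner raddfD innerDl. Qed.

Lemma sinnerZl (a : R[i]) (x y : subHilbert) : sinner (a *: x) y = a * sinner x y.
Proof. by rewrite /sinner linearZ/= innerZl. Qed.

Lemma sinnerC (x y : subHilbert) : sinner x y = (sinner y x)^*.
Proof. exact: innerC. Qed.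

Lemma sinner_ge0 (x : subHilbert) : 0 <= sinner x x.
Proof. exact: inner_ge0. Qed.

Lemma sinner_eq0 (x : subHilbert) : sinner x x = 0 -> x = 0.
Proof. by move=> /inner_eq0 x0; apply/val_inj; rewrite x0 raddf0. Qed.

Lemma sinner_complete (u : nat -> subHilbert) :
  (forall e : R[i], 0 < e -> exists N, forall m n, (N <= m)%N -> (N <= n)%N ->
     sinner (u m - u n) (u m - u n) < e) ->
  exists l, forall e : R[i], 0 < e -> exists N, forall n, (N <= n)%N ->
     sinner (u n - l) (u n - l) < e.
Proof.
move=> uc; have [e e0|l ul] := @inner_complete _ _ (val \o u).
  by have [N Ne] := uc e e0; exists N => m n Nm Nn; rewrite -raddfB; exact: Ne.
have Sl : l \in csub_mem S.
  apply/csub_memP; apply: (@csub_closed _ _ S); apply/closure_normP => e e0.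
  have [|N Ne] := ul (e ^+ 2); first by rewrite exprn_gt0.
  exists (val (u N)); first exact/csub_memP/(valP (u N)).
  rewrite -(@ltr_pXn2r _ 2) ?nnegrE ?(ltW e0)// distrC -inner_norm.
  exact: Ne.
exists (exist _ l Sl) => e e0; have [N Ne] := ul e e0.
by exists N => n Nn; rewrite /sinner raddfB; exact: Ne.
Qed.

HB.instance Definition _ := Lmodule_isHilbert.Build R subHilbert
  sinnerDl sinnerZl sinnerC sinner_ge0 sinner_eq0 sinner_complete.

End SubspaceHilbert.

Section ClosedRange.
Variables (R : realType) (H K : hilbertType R) (T : 'B(H, K)).

Lemma crange0 : closure (range T) 0.
Proof. by apply: subset_closure; exists 0 => //; rewrite linear0. Qed.

Lemma crangeP (a : R[i]) x y : closure (range T) x -> closure (range T) y ->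
  closure (range T) (a *: x + y).
Proof.
move=> /closure_normP Tx /closure_normP Ty; apply/closure_normP => e e0.
have a1 : 0 < `|a| + 1 by rewrite ltr_wpDl.
have [|_ [s _ <-] xs] := Tx (e / 2 / (`|a| + 1)); first by rewrite !divr_gt0.
have [|_ [t _ <-] yt] := Ty (e / 2); first by rewrite divr_gt0.
exists (a *: T s + T t); first by exists (a *: s + t) => //; rewrite linearP.
rewrite opprD addrACA -scalerBr (le_lt_trans (ler_normD _ _))//.
rewrite (splitr e) ltr_leD// ?ltW// normrZ.
rewrite (@le_lt_trans _ _ ((`|a| + 1) * `|x - T s|))//.
  by rewrite ler_wpM2r// lerDl.
by rewrite mulrC -ltr_pdivlMr.
Qed.

Lemma crange_closed : closed (closure (range T)).
Proof. exact: closed_closure. Qed.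

Definition crange : closedSubspace K :=
  ClosedSubspace crange0 crangeP crange_closed.

Lemma to_crange_subproof x : T x \in csub_mem crange.
Proof. by apply/csub_memP; apply: subset_closure; exists x. Qed.

Definition to_crange (x : H) : subHilbert crange :=
  exist _ (T x) (to_crange_subproof x).

End ClosedRange.

Section OrthogonalComplement.
Variables (R : realType) (H : hilbertType R) (A : set H).

Let ortho_set : set H := [set x | forall y, A y -> inner x y = 0].

Lemma ortho0 : ortho_set 0.
Proof. by move=> y _; rewrite inner0l. Qed.

Lemma orthoP (a : R[i]) x y :
  ortho_set x -> ortho_set y -> ortho_set (a *: x + y).
Proof.
by move=> ox oy z Az; rewrite innerDl innerZl ox// oy// mulr0 addr0.
Qed.

Lemma ortho_closed : closed ortho_set.
Proof.
move=> x /closure_normP ox y Ay; apply/eqP; rewrite -normr_le0.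
have y1 : 0 < `|y| + 1 by rewrite ltr_wpDl.
apply/ler_addgt0Pl => e e0; rewrite addr0.
have [|z oz xz] := ox (e / (`|y| + 1)); first by rewrite divr_gt0.
have -> : inner x y = inner (x - z) y.
  by rewrite innerDl -scaleN1r innerZl oz// mulr0 addr0.
rewrite (le_trans (cauchy_schwarz _ _))//.
rewrite (@le_trans _ _ (`|x - z| * (`|y| + 1)))//.
  by rewrite ler_wpM2l// lerDl.
by rewrite -ler_pdivlMr// ltW.
Qed.

Definition ortho : closedSubspace H := ClosedSubspace ortho0 orthoP ortho_closed.

End OrthogonalComplement.

Section BinarySum.
Variables (R : realType) (H K : hilbertType R).

(* An alias of H * K, since H * K already carries the maximum norm. *)
Definition hsum : Type := (H * K)%type.

HB.instance Definition _ := GRing.Lmodule.copy hsum (H * K)%type.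

Definition hpair (h : H) (k : K) : hsum := (h, k).

Let pinner (x y : hsum) : R[i] := inner x.1 y.1 + inner x.2 y.2.

Lemma pinnerDl (x y z : hsum) : pinner (x + y) z = pinner x z + pinner y z.
Proof. by rewrite /pinner !innerDl addrACA. Qed.

Lemma pinnerZl (a : R[i]) (x y : hsum) : pinner (a *: x) y = a * pinner x y.
Proof. by rewrite /pinner !innerZl mulrDr. Qed.

Lemma pinnerC (x y : hsum) : pinner x y = (pinner y x)^*.
Proof. by rewrite /pinner rmorphD/= -!innerC. Qed.

Lemma pinner_ge0 (x : hsum) : 0 <= pinner x x.
Proof. by rewrite addr_ge0// inner_ge0. Qed.

Lemma pinner_eq0 (x : hsum) : pinner x x = 0 -> x = 0.
Proof.
move=> /eqP; rewrite paddr_eq0 ?inner_ge0// => /andP[/eqP x1 /eqP x2].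
by case: x x1 x2 => a b /= /inner_eq0 -> /inner_eq0 ->.
Qed.

Lemma pinner_complete (u : nat -> hsum) :
  (forall e : R[i], 0 < e -> exists N, forall m n, (N <= m)%N -> (N <= n)%N ->
     pinner (u m - u n) (u m - u n) < e) ->
  exists l, forall e : R[i], 0 < e -> exists N, forall n, (N <= n)%N ->
     pinner (u n - l) (u n - l) < e.
Proof.
move=> uc.
have [e e0|l1 ul1] := @inner_complete _ _ (fun n => (u n).1).
  have [N Ne] := uc e e0; exists N => m n Nm Nn.
  by apply: le_lt_trans (Ne m n Nm Nn); rewrite /pinner lerDl inner_ge0.
have [e e0|l2 ul2] := @inner_complete _ _ (fun n => (u n).2).
  have [N Ne] := uc e e0; exists N => m n Nm Nn.
  by apply: le_lt_trans (Ne m n Nm Nn); rewrite /pinner lerDr inner_ge0.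
exists (hpair l1 l2) => e e0; have e20 : 0 < e / 2 by rewrite divr_gt0.
have [N1 N1e] := ul1 _ e20; have [N2 N2e] := ul2 _ e20.
exists (maxn N1 N2) => n; rewrite geq_max => /andP[N1n N2n].
by rewrite (splitr e) ltrD//; [exact: N1e|exact: N2e].
Qed.

HB.instance Definition _ := Lmodule_isHilbert.Build R hsum
  pinnerDl pinnerZl pinnerC pinner_ge0 pinner_eq0 pinner_complete.

End BinarySum.

Section PowerSum.
Variables (R : realType) (d : nat) (H : hilbertType R).

Definition dsum : Type := {ffun 'I_d -> H}.

HB.instance Definition _ := GRing.Lmodule.copy dsum {ffun 'I_d -> H}.

Definition dcoord (x : dsum) (i : 'I_d) : H := (x : {ffun 'I_d -> H}) i.

Let dinner (x y : dsum) : R[i] := \sum_(i < d) inner (dcoord x i) (dcoord y i).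

Lemma dinnerDl (x y z : dsum) : dinner (x + y) z = dinner x z + dinner y z.
Proof.
rewrite -big_split/=; apply: eq_bigr => i _.
by rewrite /dcoord ffunE innerDl.
Qed.

Lemma dinnerZl (a : R[i]) (x y : dsum) : dinner (a *: x) y = a * dinner x y.
Proof.
rewrite mulr_sumr; apply: eq_bigr => i _.
by rewrite /dcoord ffunE innerZl.
Qed.

Lemma dinnerC (x y : dsum) : dinner x y = (dinner y x)^*.
Proof. by rewrite rmorph_sum/=; apply: eq_bigr => i _; rewrite innerC. Qed.

Lemma dinner_ge0 (x : dsum) : 0 <= dinner x x.
Proof. by apply: sumr_ge0 => i _; exact: inner_ge0. Qed.

Lemma dinner_eq0 (x : dsum) : dinner x x = 0 -> x = 0.
Proof.
move=> /eqP; rewrite psumr_eq0; last by move=> i _; exact: inner_ge0.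
move=> /allP x0; apply/ffunP => i; rewrite ffunE; apply: inner_eq0.
by apply/eqP/x0; rewrite mem_index_enum.
Qed.

Lemma dinner_complete (u : nat -> dsum) :
  (forall e : R[i], 0 < e -> exists N, forall m n, (N <= m)%N -> (N <= n)%N ->
     dinner (u m - u n) (u m - u n) < e) ->
  exists l, forall e : R[i], 0 < e -> exists N, forall n, (N <= n)%N ->
     dinner (u n - l) (u n - l) < e.
Proof.
move=> uc.
have /choice[l ul] : forall i, exists l, forall e : R[i], 0 < e ->
    exists N, forall n, (N <= n)%N ->
    inner (dcoord (u n) i - l) (dcoord (u n) i - l) < e.
  move=> i; apply: inner_complete => e e0.
  have [N Ne] := uc e e0; exists N => m n Nm Nn.
  apply: le_lt_trans (Ne m n Nm Nn); rewrite /dinner (bigD1 i)//=.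
  rewrite /dcoord !ffunE lerDl; apply: sumr_ge0 => j _; exact: inner_ge0.
exists [ffun i => l i] => e e0.
have ed0 : 0 < e / d.+1%:R by rewrite divr_gt0.
have /choice[N Ne] := fun i => ul i _ ed0.
exists (\max_(i < d) N i)%N => n /bigmax_leqP Nn.
rewrite (@le_lt_trans _ _ (\sum_(i < d) e / d.+1%:R))//.
  by apply: ler_sum => i _; rewrite /dcoord !ffunE ltW// Ne// Nn.
rewrite sumr_const card_ord -[_ *+ d]mulr_natr mulrAC ltr_pdivrMr// ltr_pM2l//.
by rewrite ltr_nat.
Qed.

HB.instance Definition _ := Lmodule_isHilbert.Build R dsum
  dinnerDl dinnerZl dinnerC dinner_ge0 dinner_eq0 dinner_complete.

End PowerSum.

Section Fock.
Variables (R : realType) (d : nat) (H : hilbertType R).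
Local Notation word := (seq 'I_d).
Implicit Types (x y z : word -> H) (k n : nat).

(* The Hilbert space tensor product of the full Fock space over C^d with H is
   realized as the square-summable families x of vectors of H indexed by words,
   x w being the coefficient of e_w; sums over words are taken length by
   length. *)
Definition level_inner k x y : R[i] :=
  \sum_(w : k.-tuple 'I_d) inner (x w) (y w).

Definition level_normsq k x : R := complex.Re (level_inner k x x).

Definition square_summable : {pred (word -> H)} :=
  [pred x | `[< cvgn (series (fun k => level_normsq k x)) >]].

Lemma level_innerDl k x y z :
  level_inner k (x + y) z = level_inner k x z + level_inner k y z.
Proof. by rewrite -big_split; apply: eq_bigr => w _; exact: innerDl. Qed.

Lemma level_innerZl k (a : R[i]) x y :
  level_inner k (a *: x) y = a * level_inner k x y.
Proof. by rewrite mulr_sumr; apply: eq_bigr => w _; exact: innerZl. Qed.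

Lemma level_innerC k x y : level_inner k x y = (level_inner k y x)^*.
Proof. by rewrite rmorph_sum; apply: eq_bigr => w _; exact: innerC. Qed.

Lemma level_innerDr k x y z :
  level_inner k x (y + z) = level_inner k x y + level_inner k x z.
Proof. by rewrite level_innerC level_innerDl rmorphD/= -!level_innerC. Qed.

Lemma level_innerZr k (a : R[i]) x y :
  level_inner k x (a *: y) = a^* * level_inner k x y.
Proof. by rewrite level_innerC level_innerZl rmorphM/= -level_innerC. Qed.

Lemma level_inner_ge0 k x : 0 <= level_inner k x x.
Proof. by apply: sumr_ge0 => w _; exact: inner_ge0. Qed.

Lemma level_normsqE k x : (level_normsq k x)%:C%C = level_inner k x x.
Proof. by rewrite /level_normsq RRe_real// ger0_real// level_inner_ge0. Qed.

Lemma level_normsq_ge0 k x : 0 <= level_normsq k x.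
Proof. by rewrite -lecR level_normsqE level_inner_ge0. Qed.

Lemma level_normsqZ k (a : R[i]) x :
  level_normsq k (a *: x) = complex.Re `|a| ^+ 2 * level_normsq k x.
Proof.
apply: complexI; rewrite level_normsqE level_innerZl level_innerZr mulrA.
rewrite -normCK -level_normsqE -{1}(RRe_real (normr_real a)).
by rewrite rmorphM rmorphXn.
Qed.

Lemma level_parallelogram k x y :
  level_normsq k (x + y) + level_normsq k (x - y) =
  2 * level_normsq k x + 2 * level_normsq k y.
Proof.
apply: complexI; rewrite !rmorphD !rmorphM/= !level_normsqE rmorph_nat.
rewrite -[- y]scaleN1r !(level_innerDl, level_innerDr, level_innerZl,
  level_innerZr) rmorphN1 !mulN1r opprK.
set a := level_inner k x x; set b := level_inner k x y.
set c := level_inner k y x; set e := level_inner k y y.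
ring.
Qed.

Lemma level_normsqD k x y :
  level_normsq k (x + y) <= 2 * level_normsq k x + 2 * level_normsq k y.
Proof. by rewrite -level_parallelogram lerDl level_normsq_ge0. Qed.

Lemma normsq_le_level x (w : word) :
  inner (x w) (x w) <= (level_normsq (size w) x)%:C%C.
Proof.
rewrite level_normsqE /level_inner (bigD1 (in_tuple w))//= lerDl.
by apply: sumr_ge0 => v _; exact: inner_ge0.
Qed.

Lemma re_level_le k x y : `|complex.Re (level_inner k x y)| <=
  level_normsq k x + level_normsq k y.
Proof.
have := level_normsq_ge0 k (x + y); have := level_normsq_ge0 k (x - y).
have x0 := level_normsq_ge0 k x; have y0 := level_normsq_ge0 k y.
rewrite /level_normsq in x0 y0 *.
rewrite -[- y]scaleN1r !(level_innerDl, level_innerDr, level_innerZl,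
  level_innerZr) rmorphN1 !mulN1r opprK [level_inner k y x]level_innerC.
case: (level_inner k x x) x0 => a1 a2 /= x0.
case: (level_inner k y y) y0 => c1 c2 /= y0.
case: (level_inner k x y) => b1 b2 /= h1 h2.
by rewrite ler_norml; apply/andP; split; lra.
Qed.

Lemma conj_complexE (z : R[i]) : z^* = conjc z.
Proof. by []. Qed.

Lemma re_complexD (z t : R[i]) :
  complex.Re (z + t) = complex.Re z + complex.Re t.
Proof. by case: z; case: t. Qed.

Lemma im_complexD (z t : R[i]) :
  complex.Im (z + t) = complex.Im z + complex.Im t.
Proof. by case: z; case: t. Qed.

Lemma re_complexM (z t : R[i]) : complex.Re (z * t) =
  complex.Re z * complex.Re t - complex.Im z * complex.Im t.
Proof. by case: z; case: t. Qed.

Lemma im_complexM (z t : R[i]) : complex.Im (z * t) =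
  complex.Re z * complex.Im t + complex.Im z * complex.Re t.
Proof. by case: z; case: t. Qed.

Lemma re_conj (z : R[i]) : complex.Re (z^*) = complex.Re z.
Proof. by rewrite conj_complexE; case: z. Qed.

Lemma im_conj (z : R[i]) : complex.Im (z^*) = - complex.Im z.
Proof. by rewrite conj_complexE; case: z. Qed.

Lemma im_level_le k x y : `|complex.Im (level_inner k x y)| <=
  level_normsq k x + level_normsq k y.
Proof.
have := re_level_le k x ('i%C *: y).
rewrite level_innerZr level_normsqZ normc_def/= expr0n/= add0r expr1n sqrtr1.
rewrite expr1n mul1r; congr (`|_| <= _).
by rewrite conj_complexE; case: (level_inner k x y) => a b /=; ring.
Qed.

Lemma square_summableP x :
  reflect (cvgn (series (fun k => level_normsq k x))) (x \in square_summable).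
Proof. exact: asboolP. Qed.

Lemma square_summable_le x (v : nat -> R) : cvgn (series v) ->
  (forall k, level_normsq k x <= v k) -> x \in square_summable.
Proof.
move=> cv xv; apply/square_summableP; apply: series_le_cvg cv => // k.
- exact: level_normsq_ge0.
- exact: le_trans (level_normsq_ge0 k x) (xv k).
Qed.

Lemma square_summable_submod : GRing.subsemimod_closed square_summable.
Proof.
split; [split|].
- apply: (@square_summable_le _ (fun=> 0)) => [|k].
    rewrite (_ : series _ = fun=> 0); first exact: is_cvg_cst.
    by apply/funext => n; rewrite /series/= big1.
  rewrite /level_normsq /level_inner big1//= => w _; exact: inner0l.
- move=> x y /square_summableP cx /square_summableP cy.
  apply: (@square_summable_le _ (2 *: (fun k => level_normsq k x)
    + 2 *: (fun k => level_normsq k y))) => [|k]; last exact: level_normsqD.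
  by apply: is_cvg_seriesD; apply: is_cvg_seriesZ.
- move=> a x /square_summableP cx.
  apply: (@square_summable_le _ (complex.Re `|a| ^+ 2 *:
    (fun k => level_normsq k x))) => [|k]; last by rewrite level_normsqZ.
  exact: is_cvg_seriesZ.
Qed.
HB.instance Definition _ := GRing.isSubmodClosed.Build R[i] (word -> H)
  square_summable square_summable_submod.

Definition fock : Type := {x : word -> H | x \in square_summable}.

HB.instance Definition _ := SubType.on fock.
HB.instance Definition _ := Choice.on fock.
HB.instance Definition _ := [SubChoice_isSubLmodule of fock by <:].

Definition fock_inner (x y : fock) : R[i] :=
  (limn (series (fun k => complex.Re (level_inner k (val x) (val y)))) +i*
   limn (series (fun k => complex.Im (level_inner k (val x) (val y)))))%C.

Lemma cvg_re_level (x y : fock) :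
  cvgn (series (fun k => complex.Re (level_inner k (val x) (val y)))).
Proof.
have /square_summableP cx := valP x; have /square_summableP cy := valP y.
apply: normed_cvg; apply: series_le_cvg (is_cvg_seriesD cx cy) => k //=.
  by rewrite addr_ge0// level_normsq_ge0.
exact: re_level_le.
Qed.

Lemma cvg_im_level (x y : fock) :
  cvgn (series (fun k => complex.Im (level_inner k (val x) (val y)))).
Proof.
have /square_summableP cx := valP x; have /square_summableP cy := valP y.
apply: normed_cvg; apply: series_le_cvg (is_cvg_seriesD cx cy) => k //=.
  by rewrite addr_ge0// level_normsq_ge0.
exact: im_level_le.
Qed.


Lemma fock_innerDl (x y z : fock) :
  fock_inner (x + y) z = fock_inner x z + fock_inner y z.
Proof.
have lD k : level_inner k (val (x + y)) (val z) =
    level_inner k (val x) (val z) + level_inner k (val y) (val z).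
  by rewrite raddfD level_innerDl.
congr (_ +i* _)%C.
  rewrite -(lim_seriesD (@cvg_re_level x z) (@cvg_re_level y z)).
  congr (limn (series _)); apply/funext => k; rewrite lD.
  exact: re_complexD.
rewrite -(lim_seriesD (@cvg_im_level x z) (@cvg_im_level y z)).
congr (limn (series _)); apply/funext => k; rewrite lD.
exact: im_complexD.
Qed.

Lemma fock_innerZl (a : R[i]) (x y : fock) :
  fock_inner (a *: x) y = a * fock_inner x y.
Proof.
have lZ k : level_inner k (val (a *: x)) (val y) =
    a * level_inner k (val x) (val y).
  by rewrite linearZ level_innerZl.
case: a lZ => a b lZ.
have cr := @cvg_re_level x y; have ci := @cvg_im_level x y.
congr (_ +i* _)%C.
  rewrite -[a * _]/(a *: _) -[b * _]/(b *: _) -!lim_seriesZ//.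
  rewrite -lim_seriesB; [|exact: is_cvg_seriesZ cr|exact: is_cvg_seriesZ ci].
  congr (limn (series _)); apply/funext => k; rewrite lZ.
  exact: (re_complexM (a +i* b)%C).
rewrite -[a * _]/(a *: _) -[b * _]/(b *: _) -!lim_seriesZ//.
rewrite -lim_seriesD; [|exact: is_cvg_seriesZ ci|exact: is_cvg_seriesZ cr].
congr (limn (series _)); apply/funext => k; rewrite lZ.
exact: (im_complexM (a +i* b)%C).
Qed.

Lemma fock_innerC (x y : fock) : fock_inner x y = (fock_inner y x)^*.
Proof.
rewrite conj_complexE; congr (_ +i* _)%C.
  congr (limn (series _)); apply/funext => k; rewrite level_innerC.
  exact: re_conj.
rewrite -(lim_seriesN (@cvg_im_level y x)).
congr (limn (series _)); apply/funext => k; rewrite level_innerC.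
exact: im_conj.
Qed.

Definition fock_normsq (x : fock) : R :=
  limn (series (fun k => level_normsq k (val x))).

Lemma fock_innerxx (x : fock) : fock_inner x x = (fock_normsq x)%:C%C.
Proof.
apply/eqP; rewrite eq_complex/= eqxx/=; apply/eqP.
rewrite (_ : (fun k => _) = fun=> 0); last first.
  apply/funext => k; rewrite -level_normsqE//.
rewrite (_ : series _ = fun=> 0); first exact: lim_cst.
by apply/funext => n; rewrite /series/= big1.
Qed.

Lemma series_le_fock_normsq n (x : fock) :
  series (fun k => level_normsq k (val x)) n <= fock_normsq x.
Proof.
apply: nondecreasing_cvgn_le; last exact/square_summableP/valP.
by apply: nondecreasing_series => k _ _; exact: level_normsq_ge0.
Qed.

Lemma level_le_fock_normsq k (x : fock) :
  level_normsq k (val x) <= fock_normsq x.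
Proof.
apply: le_trans (series_le_fock_normsq k.+1 x).
rewrite seriesSr lerDr /series/=; apply: sumr_ge0 => j _.
exact: level_normsq_ge0.
Qed.

Lemma fock_inner_ge0 (x : fock) : 0 <= fock_inner x x.
Proof.
rewrite fock_innerxx lecR (le_trans _ (series_le_fock_normsq 0 x))//.
by rewrite /series/= big_geq.
Qed.

Lemma coord_le_fock_normsq (x : fock) (w : word) :
  inner (val x w) (val x w) <= fock_inner x x.
Proof.
rewrite (le_trans (normsq_le_level _ _))// fock_innerxx lecR.
exact: level_le_fock_normsq.
Qed.

Lemma fock_inner_eq0 (x : fock) : fock_inner x x = 0 -> x = 0.
Proof.
move=> x0; apply/val_inj/funext => w; rewrite raddf0.
apply: inner_eq0; apply/eqP; rewrite eq_le inner_ge0 andbT.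
by rewrite -x0; exact: coord_le_fock_normsq.
Qed.

Lemma level_normsq_small k (v : nat -> word -> H) :
  (forall w (e : R[i]), 0 < e -> exists N, forall p, (N <= p)%N ->
     inner (v p w) (v p w) < e) ->
  forall e : R, 0 < e -> exists N, forall p, (N <= p)%N ->
     level_normsq k (v p) < e.
Proof.
move=> v0 e e0; pose c := #|{: k.-tuple 'I_d}|.
have ec0 : 0 < (e / c.+1%:R)%:C%C :> R[i].
  by rewrite -[0]/(0%:C%C) ltcR divr_gt0.
have /choice[N Ne] := fun w : k.-tuple 'I_d => v0 w _ ec0.
exists (\max_w N w)%N => p /bigmax_leqP Np.
rewrite -ltcR level_normsqE.
rewrite (@le_lt_trans _ _ (\sum_(w : k.-tuple 'I_d) (e / c.+1%:R)%:C%C))//.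
  by apply: ler_sum => w _; rewrite ltW// Ne// Np.
rewrite sumr_const -/c -rmorphMn ltcR -[_ *+ c]mulr_natr mulrAC.
by rewrite ltr_pdivrMr// ltr_pM2l// ltr_nat.
Qed.

Lemma series_level_normsq_small n (v : nat -> word -> H) :
  (forall w (e : R[i]), 0 < e -> exists N, forall p, (N <= p)%N ->
     inner (v p w) (v p w) < e) ->
  forall e : R, 0 < e -> exists N, forall p, (N <= p)%N ->
     series (fun k => level_normsq k (v p)) n < e.
Proof.
move=> v0; elim: n => [|n IHn] e e0.
  by exists 0%N => p _; rewrite /series/= big_geq.
have e20 : 0 < e / 2 by rewrite divr_gt0.
have [N1 N1e] := IHn _ e20; have [N2 N2e] := level_normsq_small n v0 e20.
exists (maxn N1 N2) => p; rewrite geq_max => /andP[N1p N2p].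
by rewrite seriesSr (splitr e) ltrD// ?N1e// N2e.
Qed.

Lemma series_level_normsqD n x y :
  series (fun k => level_normsq k (x + y)) n <=
  2 * series (fun k => level_normsq k x) n +
  2 * series (fun k => level_normsq k y) n.
Proof.
rewrite /series/= !mulr_sumr -big_split/=; apply: ler_sum => k _.
exact: level_normsqD.
Qed.

Lemma square_summable_bounded x (M : R) :
  (forall n, series (fun k => level_normsq k x) n <= M) ->
  x \in square_summable.
Proof.
move=> xM; apply/square_summableP; apply: nondecreasing_is_cvgn.
  by apply: nondecreasing_series => k _ _; exact: level_normsq_ge0.
by exists M => _ [n _ <-].
Qed.

Lemma fock_normsq_le (x : fock) (M : R) :
  (forall n, series (fun k => level_normsq k (val x)) n <= M) ->
  fock_normsq x <= M.
Proof.
move=> xM; apply: limr_le; first exact/square_summableP/valP.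
by near=> n; exact: xM.
Unshelve. all: by end_near. Qed.

Lemma fock_inner_complete (u : nat -> fock) :
  (forall e : R[i], 0 < e -> exists N, forall m n, (N <= m)%N -> (N <= n)%N ->
     fock_inner (u m - u n) (u m - u n) < e) ->
  exists l, forall e : R[i], 0 < e -> exists N, forall n, (N <= n)%N ->
     fock_inner (u n - l) (u n - l) < e.
Proof.
move=> uc.
have /choice[l ul] : forall w, exists l, forall e : R[i], 0 < e ->
    exists N, forall n, (N <= n)%N ->
    inner (val (u n) w - l) (val (u n) w - l) < e.
  move=> w; apply: inner_complete => e e0.
  have [N Ne] := uc e e0; exists N => m n Nm Nn.
  apply: le_lt_trans (Ne m n Nm Nn).
  by apply: le_trans (coord_le_fock_normsq _ w); rewrite raddfB.
have small (e : R) : 0 < e -> exists N, forall m, (N <= m)%N ->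
    forall n, series (fun k => level_normsq k (val (u m) - l)) n <= e.
  move=> e0; have e40 : 0 < e / 4 by rewrite divr_gt0.
  have [|N Ne] := uc (e / 4)%:C%C; first by rewrite -[0]/(0%:C%C) ltcR.
  exists N => m Nm n.
  have [N' N'e] := @series_level_normsq_small n (fun p => val (u p) - l) ul _ e40.
  pose p := maxn N N'.
  have -> : val (u m) - l = val (u m - u p) + (val (u p) - l).
    by rewrite raddfB addrA subrK.
  rewrite (le_trans (series_level_normsqD _ _ _))//.
  have h1 : series (fun k => level_normsq k (val (u m - u p))) n < e / 4.
    rewrite (le_lt_trans (series_le_fock_normsq _ _))//.
    by rewrite -ltcR -fock_innerxx Ne// leq_maxl.
  have h2 := N'e p (leq_maxr _ _).
  by move: h1 h2; lra.
have l2 : l \in square_summable.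
  have [|N Ne] := small 1; first exact: ltr01.
  have -> : l = val (u N) - (val (u N) - l) by rewrite subKr.
  apply: rpredB; first exact: valP.
  exact: square_summable_bounded (Ne N (leqnn N)).
exists (exist _ l l2) => e e0.
have eE : e = (complex.Re e)%:C%C by rewrite RRe_real// gtr0_real.
have re0 : 0 < complex.Re e by rewrite -ltcR -eE.
have [|N Ne] := small (complex.Re e / 2); first by rewrite divr_gt0.
exists N => m Nm; rewrite fock_innerxx eE ltcR.
rewrite (@le_lt_trans _ _ (complex.Re e / 2))//; last by move: re0; lra.
by apply: fock_normsq_le => n; rewrite raddfB; exact: Ne.
Qed.

HB.instance Definition _ := Lmodule_isHilbert.Build R fock
  fock_innerDl fock_innerZl fock_innerC fock_inner_ge0 fock_inner_eq0
  fock_inner_complete.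

End Fock.
Section DirectSumOperators.
Variables (R : realType).

Section RowOperator.
Variables (d : nat) (H K : hilbertType R).

Lemma dcoord_le (x : dsum d H) i : `|dcoord x i| <= `|x|.
Proof.
rewrite -(@ler_pXn2r _ 2) ?nnegrE// -!inner_norm.
rewrite [leRHS](bigD1 i)//= lerDl; apply: sumr_ge0 => j _.
exact: inner_ge0.
Qed.

Definition rowop (T : 'I_d -> 'B(H, K)) (x : dsum d H) : K :=
  \sum_(i < d) T i (dcoord x i).

Lemma rowop_linear (T : 'I_d -> 'B(H, K)) : linear (rowop T).
Proof.
move=> a x y; rewrite scaler_sumr -big_split; apply: eq_bigr => i _ /=.
by rewrite -linearP /dcoord !ffunE.
Qed.
HB.instance Definition _ T :=
  @GRing.isLinear.Build R[i] (dsum d H) K _ (rowop T) (rowop_linear T).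

Lemma rowop_bounded (T : 'I_d -> 'B(H, K)) :
  exists M : R[i], forall x, `|rowop T x| <= M * `|x|.
Proof.
have /choice[M TM] : forall i, exists M : R[i],
    0 <= M /\ forall x, `|T i x| <= M * `|x|.
  by move=> i; have [M M0 MT] := op_boundedE (T i); exists M.
exists (\sum_i M i) => x; rewrite (le_trans (ler_norm_sum _ _ _))// mulr_suml.
apply: ler_sum => i _; have [M0 MT] := TM i.
by rewrite (le_trans (MT _))// ler_wpM2l// dcoord_le.
Qed.
HB.instance Definition _ T := isBoundedOp.Build R (dsum d H) K (rowop T) (rowop_bounded T).

End RowOperator.

Section Inclusion.
Variables (d : nat) (H : hilbertType R) (j : 'I_d).

Definition dincl (h : H) : dsum d H := [ffun i => if i == j then h else 0].

Lemma dincl_linear : linear dincl.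
Proof.
move=> a x y; apply/ffunP => i; rewrite !ffunE.
by case: eqP => // _; rewrite scaler0 addr0.
Qed.
HB.instance Definition _ :=
  @GRing.isLinear.Build R[i] H (dsum d H) _ dincl dincl_linear.

Lemma dincl_bounded : exists M : R[i], forall x, `|dincl x| <= M * `|x|.
Proof.
exists 1 => x; rewrite mul1r -(@ler_pXn2r _ 2) ?nnegrE// -!inner_norm.
rewrite [leLHS](bigD1 j)//= big1 => [|i /negPf ij].
  by rewrite /dcoord ffunE eqxx addr0.
by rewrite /dcoord ffunE ij inner0l.
Qed.
HB.instance Definition _ := isBoundedOp.Build R H (dsum d H) dincl dincl_bounded.

End Inclusion.

Section Block.
Variables (H1 H2 K1 K2 : hilbertType R).
Variables (a : 'B(H1, K1)) (b : 'B(H2, K1)) (c : 'B(H1, K2)) (e : 'B(H2, K2)).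

Definition block2 (x : hsum H1 H2) : hsum K1 K2 :=
  hpair (a x.1 + b x.2) (c x.1 + e x.2).

Lemma block2_linear : linear block2.
Proof.
move=> k x y; congr pair => /=; rewrite !linearP scalerDr !addrA.
  by congr (_ + _); rewrite addrAC.
by congr (_ + _); rewrite addrAC.
Qed.
HB.instance Definition _ :=
  @GRing.isLinear.Build R[i] (hsum H1 H2) (hsum K1 K2) _ block2 block2_linear.

Lemma fst_le (G L : hilbertType R) (x : hsum G L) : `|x.1| <= `|x|.
Proof.
rewrite -(@ler_pXn2r _ 2) ?nnegrE// -!inner_norm.
by rewrite [leRHS]/inner/= lerDl inner_ge0.
Qed.

Lemma snd_le (G L : hilbertType R) (x : hsum G L) : `|x.2| <= `|x|.
Proof.
rewrite -(@ler_pXn2r _ 2) ?nnegrE// -!inner_norm.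
by rewrite [leRHS]/inner/= lerDr inner_ge0.
Qed.

Lemma hpair_le (G L : hilbertType R) (g : G) (l : L) :
  `|hpair g l| <= `|g| + `|l|.
Proof.
rewrite -(@ler_pXn2r _ 2) ?nnegrE ?addr_ge0// -inner_norm.
rewrite [leLHS]/inner/= !inner_norm sqrrD addrAC lerDl.
by rewrite mulrn_wge0// mulr_ge0.
Qed.

Lemma block2_bounded : exists M : R[i], forall x, `|block2 x| <= M * `|x|.
Proof.
have [Ma Ma0 Ha] := op_boundedE a; have [Mb Mb0 Hb] := op_boundedE b.
have [Mc Mc0 Hc] := op_boundedE c; have [Me Me0 He] := op_boundedE e.
exists ((Ma + Mb) + (Mc + Me)) => x; rewrite (le_trans (hpair_le _ _))// mulrDl.
by rewrite lerD// (le_trans (ler_normD _ _))// mulrDl lerD//;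
  [rewrite (le_trans (Ha _))|rewrite (le_trans (Hb _))|
   rewrite (le_trans (Hc _))|rewrite (le_trans (He _))];
  rewrite // ler_wpM2l// ?fst_le ?snd_le.
Qed.
HB.instance Definition _ :=
  isBoundedOp.Build R (hsum H1 H2) (hsum K1 K2) block2 block2_bounded.

End Block.

Section ToClosedRange.
Variables (H K : hilbertType R) (T : 'B(H, K)).

Lemma to_crange_linear : linear (to_crange T).
Proof. by move=> a x y; apply/val_inj; rewrite linearP/= linearP. Qed.
HB.instance Definition _ :=
  @GRing.isLinear.Build R[i] H (subHilbert (crange T)) _ (to_crange T)
    to_crange_linear.

Lemma to_crange_bounded :
  exists M : R[i], forall x, `|to_crange T x| <= M * `|x|.
Proof.
have [M M0 TM] := op_boundedE T; exists M => x.
rewrite (le_trans _ (TM x))// -(@ler_pXn2r _ 2) ?nnegrE//.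
by rewrite -!inner_norm.
Qed.
HB.instance Definition _ :=
  isBoundedOp.Build R H (subHilbert (crange T)) (to_crange T) to_crange_bounded.

End ToClosedRange.

End DirectSumOperators.

Section FockOperators.
Variables (R : realType) (d : nat).
Local Notation word := (seq 'I_d).

Lemma fock_norm_le (H K : hilbertType R) (x : K) (y : fock d H) (M : R[i]) :
  0 <= M -> (forall n, series (fun k => level_normsq k (val y)) n <=
    complex.Re M ^+ 2 * complex.Re (inner x x)) -> `|y| <= M * `|x|.
Proof.
move=> M0 yM; rewrite -(@ler_pXn2r _ 2) ?nnegrE ?mulr_ge0// exprMn.
rewrite -!inner_norm [leLHS]fock_innerxx.
rewrite -(RRe_real (ger0_real M0)) -(RRe_real (ger0_real (inner_ge0 x))).
by rewrite -rmorphXn -rmorphM lecR; exact: fock_normsq_le.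
Qed.

Section Vacuum.
Variable H : hilbertType R.

Let vac (h : H) : word -> H := fun w => if w is [::] then h else 0.

Lemma series_vac h n :
  series (fun k => level_normsq k (vac h)) n <= complex.Re (inner h h).
Proof.
have h0 : 0 <= complex.Re (inner h h).
  by rewrite -lecR RRe_real ?ger0_real ?inner_ge0.
case: n => [|n]; first by rewrite /series/= big_geq.
rewrite /series/= big_nat_recl//= big1 => [|k _].
  rewrite addr0 /level_normsq /level_inner.
  rewrite (bigD1 [tuple])//= big1 ?addr0// => w.
  by move=> /eqP[]; exact: tuple0.
rewrite /level_normsq /level_inner big1// => w _.
by case/tupleP: w => i w /=; exact: inner0l.
Qed.

Lemma vac_summable h : vac h \in @square_summable R d H.
Proof. exact: square_summable_bounded (series_vac h). Qed.

(* h |-> e_0 (x) h *)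
Definition fock_vac (h : H) : fock d H := exist _ (vac h) (vac_summable h).

Lemma fock_vac_linear : linear fock_vac.
Proof.
move=> a x y; apply/val_inj/funext; rewrite linearP/= => -[|i w] //=.
by rewrite [RHS]/GRing.add/= [X in X + _]/GRing.scale/= scaler0 addr0.
Qed.
HB.instance Definition _ :=
  @GRing.isLinear.Build R[i] H (fock d H) _ fock_vac fock_vac_linear.

Lemma fock_vac_bounded : exists M : R[i], forall x, `|fock_vac x| <= M * `|x|.
Proof.
exists 1 => x; apply: fock_norm_le => // n.
by rewrite expr1n mul1r series_vac.
Qed.
HB.instance Definition _ :=
  isBoundedOp.Build R H (fock d H) fock_vac fock_vac_bounded.

End Vacuum.

Section Creation.
Variables (H : hilbertType R) (i : 'I_d).

Let create (x : word -> H) : word -> H :=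
  fun w => if w is j :: v then if j == i then x v else 0 else 0.

Lemma level_create k x : level_normsq k.+1 (create x) = level_normsq k x.
Proof.
congr complex.Re; rewrite /level_inner.
rewrite (reindex (fun p : 'I_d * k.-tuple 'I_d => cons_tuple p.1 p.2))/=.
  rewrite -(pair_bigA _ (fun j (v : k.-tuple 'I_d) =>
    inner (if j == i then x v else 0) (if j == i then x v else 0)))/=.
  rewrite (bigD1 i)//= [X in _ + X]big1 => [|j /negPf ji].
    by rewrite addr0; apply: eq_bigr => v _; rewrite eqxx.
  by rewrite big1// => v _; rewrite ji inner0l.
exists (fun w : k.+1.-tuple 'I_d => (thead w, behead_tuple w)) => /=.
  by case=> j v _ /=; congr pair; exact: val_inj.
by move=> w _; rewrite [RHS]tuple_eta; exact: val_inj.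
Qed.

Lemma series_create x n : series (fun k => level_normsq k (create x)) n.+1 =
  series (fun k => level_normsq k x) n.
Proof.
rewrite /series/= big_nat_recl//= {1}/level_normsq /level_inner big1 => [|w _].
  by rewrite add0r; apply: eq_bigr => k _; rewrite level_create.
by rewrite tuple0; exact: inner0l.
Qed.

Lemma series_create_le (x : fock d H) n :
  series (fun k => level_normsq k (create (val x))) n <= fock_normsq x.
Proof.
case: n => [|n]; last by rewrite series_create series_le_fock_normsq.
apply: le_trans (series_le_fock_normsq 0 x).
by rewrite /series/= !big_geq.
Qed.

Lemma create_summable (x : fock d H) : create (val x) \in @square_summable R d H.
Proof. exact: square_summable_bounded (series_create_le x). Qed.

(* L_i (x) I, prefixing the words by i *)
Definition creation (x : fock d H) : fock d H :=
  exist _ (create (val x)) (create_summable x).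

Lemma creation_linear : linear creation.
Proof.
move=> a x y; apply/val_inj/funext; rewrite linearP/= => -[|j w] /=.
  by rewrite [RHS]/GRing.add/= [X in X + _]/GRing.scale/= scaler0 addr0.
rewrite [RHS]/GRing.add/= [X in _ = X + _]/GRing.scale/=.
by case: eqP => // _; rewrite scaler0 addr0.
Qed.
HB.instance Definition _ :=
  @GRing.isLinear.Build R[i] (fock d H) (fock d H) _ creation creation_linear.

Lemma creation_bounded : exists M : R[i], forall x, `|creation x| <= M * `|x|.
Proof.
exists 1 => x; apply: fock_norm_le => // n.
by rewrite expr1n mul1r [inner _ _]fock_innerxx series_create_le.
Qed.
HB.instance Definition _ :=
  isBoundedOp.Build R (fock d H) (fock d H) creation creation_bounded.

End Creation.

Section Ampliation.
Variables (H K : hilbertType R) (T : 'B(H, K)).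

Let amp (x : word -> H) : word -> K := fun w => T (x w).

Lemma level_amp (M : R[i]) : 0 <= M -> (forall h, `|T h| <= M * `|h|) ->
  forall k x, level_normsq k (amp x) <= complex.Re M ^+ 2 * level_normsq k x.
Proof.
move=> M0 TM k x; rewrite -lecR level_normsqE rmorphM rmorphXn.
rewrite /= level_normsqE.
have -> : (complex.Re M)%:C%C = M by rewrite RRe_real// ger0_real.
rewrite mulr_sumr; apply: ler_sum => w _.
by rewrite !inner_norm -exprMn lerXn2r ?nnegrE ?mulr_ge0//; exact: TM.
Qed.

Lemma series_amp (M : R[i]) : 0 <= M -> (forall h, `|T h| <= M * `|h|) ->
  forall (x : fock d H) n, series (fun k => level_normsq k (amp (val x))) n <=
    complex.Re M ^+ 2 * fock_normsq x.
Proof.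
move=> M0 TM x n.
apply: (@le_trans _ _
  (complex.Re M ^+ 2 * series (fun k => level_normsq k (val x)) n)).
  rewrite /series/= mulr_sumr; apply: ler_sum => k _; exact: level_amp.
by rewrite ler_wpM2l ?sqr_ge0 ?series_le_fock_normsq.
Qed.

Lemma amp_summable (x : fock d H) : amp (val x) \in @square_summable R d K.
Proof.
have [M M0 TM] := op_boundedE T.
exact: square_summable_bounded (series_amp M0 TM x).
Qed.

(* I (x) T *)
Definition ampliation (x : fock d H) : fock d K :=
  exist _ (amp (val x)) (amp_summable x).

Lemma ampliation_linear : linear ampliation.
Proof.
move=> a x y; apply/val_inj/funext => w; rewrite [in RHS]linearP.
have E : val (a *: x + y) = a *: val x + val y by rewrite linearP.
transitivity (T (a *: val x w + val y w)); last exact: linearP.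
exact: (congr1 (fun f : word -> H => T (f w)) E).
Qed.
HB.instance Definition _ :=
  @GRing.isLinear.Build R[i] (fock d H) (fock d K) _ ampliation ampliation_linear.

Lemma ampliation_bounded :
  exists M : R[i], forall x, `|ampliation x| <= M * `|x|.
Proof.
have [M M0 TM] := op_boundedE T; exists M => x; apply: fock_norm_le => // n.
by rewrite [inner _ _]fock_innerxx series_amp.
Qed.
HB.instance Definition _ :=
  isBoundedOp.Build R (fock d H) (fock d K) ampliation ampliation_bounded.

End Ampliation.

End FockOperators.

Section Operators.
Variable R : realType.
Implicit Types H K : hilbertType R.

(* The unique S with <T x, y> = <x, S y>; it exists by the Riesz theorem. *)
Definition adj H K (T : 'B(H, K)) : 'B(K, H) :=
  xget (\0 : 'B(K, H))
    [set S : 'B(K, H) | forall x y, inner (T x) y = inner x (S y)].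

Definition positive H (T : 'B(H, H)) : Prop := forall x, 0 <= inner (T x) x.

(* The unique positive square root, which exists whenever T is positive. *)
Definition psqrt H (T : 'B(H, H)) : 'B(H, H) :=
  xget (\0 : 'B(H, H))
    [set S : 'B(H, H) | positive S /\ forall x, S (S x) = T x].

Definition contractive H K (T : 'B(H, K)) : Prop := forall x, `|T x| <= `|x|.

Definition isometric H K (T : 'B(H, K)) : Prop := forall x, `|T x| = `|x|.

Definition unitary H K (U : 'B(H, K)) : Prop :=
  (forall x, adj U (U x) = x) /\ (forall y, U (adj U y) = y).

(* (I - T^* T)^{1/2} and (I - T T^* )^{1/2} *)
Definition defect H K (T : 'B(H, K)) : 'B(H, H) :=
  psqrt (idfun \- (adj T \o T)).

Definition codefect H K (T : 'B(H, K)) : 'B(K, K) :=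
  psqrt (idfun \- (T \o adj T)).

Definition defect_space H K (T : 'B(H, K)) : hilbertType R :=
  subHilbert (crange (defect T)).

Definition codefect_space H K (T : 'B(H, K)) : hilbertType R :=
  subHilbert (crange (codefect T)).

End Operators.

Section Tuples.
Variables (R : realType) (d : nat).
Implicit Types H K D : hilbertType R.

(* sum_i T_i T_i^* <= I *)
Definition row_contraction H (T : 'I_d -> 'B(H, H)) : Prop :=
  forall x, 0 <= inner (x - \sum_(i < d) T i (adj (T i) x)) x.

(* T_alpha = T_{alpha_1} ... T_{alpha_n} *)
Fixpoint word_op H (T : 'I_d -> 'B(H, H)) (w : seq 'I_d) : 'B(H, H) :=
  if w is i :: v then T i \o word_op T v else idfun.

Definition multi_analytic H K (M : 'B(fock d H, fock d K)) : Prop :=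
  forall i x, M (creation i x) = creation i (M x).

Definition symbol H K (M : 'B(fock d H, fock d K)) : 'B(H, fock d K) :=
  M \o @fock_vac R d H.

Definition equivalent_symbols H1 H2 K
    (theta1 : 'B(H1, fock d K)) (theta2 : 'B(H2, fock d K)) : Prop :=
  exists2 v : 'B(H1, H2), unitary v & forall x, theta1 x = theta2 (v x).

(* The value of theta at the word k :: w is the coefficient of
   e_k (x) e_w in the orthogonal expansion of theta x. *)
Definition is_characteristic_function H (A : 'I_d -> 'B(H, H))
    (theta : 'B(defect_space (rowop A), fock d (codefect_space (rowop A)))) : Prop :=
  forall x : defect_space (rowop A),
    sval (sval (theta x) [::]) = - rowop A (sval x) /\
    forall k w, sval (theta x) (k :: w) =
      to_crange (codefect (rowop A))
        (adj (word_op A w) (dcoord (defect (rowop A) (sval x)) k)).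

End Tuples.

Section Lifting.
Variables (R : realType) (d : nat) (HC : hilbertType R).
Variable C : 'I_d -> 'B(HC, HC).
Local Notation DC := (defect_space (rowop C)).

(* V_i (h (+) xi) = C_i h (+) (e_0 (x) D_C iota_i h + (L_i (x) I) xi) *)
Definition isometric_dilation (i : 'I_d) :
    'B(hsum HC (fock d DC), hsum HC (fock d DC)) :=
  block2 (C i) \0
    (@fock_vac R d DC \o (to_crange (defect (rowop C)) \o @dincl R d HC i))
    (creation i).

Section AssociatedLifting.
Variables (D : hilbertType R) (M : 'B(fock d D, fock d DC)).

(* defect M is Delta_theta *)
Definition lifting_space : hilbertType R :=
  subHilbert (ortho [set z : hsum (fock d DC) (defect_space M) |
    exists f, z = hpair (M f) (to_crange (defect M) f)]).

Definition lifting_embed (x : hsum HC lifting_space) :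
    hsum (hsum HC (fock d DC)) (defect_space M) :=
  hpair (hpair x.1 (sval x.2).1) (sval x.2).2.

(* E = [[C, 0], [B, A]] satisfies E_i^* = (V_i (+) Y_i)^* on HC (+) HA, which
   entails that HC (+) HA is invariant under (V_i (+) Y_i)^*. *)
Definition associated_lifting (B : 'I_d -> 'B(HC, lifting_space))
    (A : 'I_d -> 'B(lifting_space, lifting_space)) : Prop :=
  exists Y : 'I_d -> 'B(defect_space M, defect_space M),
    (forall i, isometric (Y i) /\
       forall f, Y i (to_crange (defect M) f) =
         to_crange (defect M) (creation i f)) /\
    (forall i x,
       lifting_embed (adj (block2 (C i) \0 (B i) (A i)) x) =
       adj (block2 (isometric_dilation i) \0 \0 (Y i)) (lifting_embed x)).

End AssociatedLifting.

(* gamma is a contraction with B^* = D_C gamma D_{*,A} *)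
Definition lifting_contraction (HA : hilbertType R)
    (B : 'I_d -> 'B(HC, HA)) (A : 'I_d -> 'B(HA, HA))
    (gamma : 'B(codefect_space (rowop A), DC)) : Prop :=
  contractive gamma /\
  forall a, adj (rowop B) a =
    defect (rowop C) (sval (gamma (to_crange (codefect (rowop A)) a))).

End Lifting.

(* Main.v *)
(* The space H_A of the lifting is invariant under the adjoints of
   S_i = L_i (+) Y_i, and A_i^* is the restriction of S_i^*; hence
   gamma D_{*,A} a is the vacuum coefficient of the first component of a, and
   that component is (I (x) gamma) K a, where
   K a = sum_alpha e_alpha (x) D_{*,A} A_alpha^* a.

   If theta = theta' v, then v induces a unitary H_A -> H_A' intertwining the
   A_i^*, and it induces U and Ut.

   Conversely, I - M M^* = (I (x) gamma) K K^* (I (x) gamma)^*, and K K^* is the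
   defect I - M_{thA} M_{thA}^*. Compressing to the vacuum, with
   y = (I (x) gamma)^* x,
     |theta^* x|^2 = |x_0|^2 - |y_0|^2 + |thA^* y|^2.
   The right-hand side is invariant under the pair (U, Ut), so
   theta^* x |-> theta'^* x is isometric; both ranges are dense because theta
   and theta' are injective, and the adjoint relation gives theta = theta' v. *)

From HB Require Import structures.
Require Import Defs.
From mathcomp Require Import all_boot all_order all_algebra.
From mathcomp Require Import complex.
From mathcomp Require Import all_classical all_reals.
From mathcomp Require Import topology normedtype sequences.
From mathcomp Require Import ring lra.

Set Implicit Arguments.
Unset Strict Implicit.
Unset Printing Implicit Defensive.

Import Order.TTheory GRing.Theory Num.Theory.
Import numFieldNormedType.Exports.

Local Open Scope ring_scope.

(** * Hilbert spaces and the Riesz theorem *)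

(** [adj] and [psqrt] are defined by choice, so nothing is known of them until existence and, for
    the square root, uniqueness are proved. The Riesz theorem is stated through an auxiliary linear
    map [f : G -> H], so that it yields adjoints as well as extensions of isometries. The unitaries
    v, U, Ut and the one between the defect spaces of M and M' then come from one principle: two
    linear maps with total ranges and equal norms differ by a unitary. The square root is built as a
    limit of polynomials, because the property of it that matters is T D_T = D_{*,T} T, and
    polynomials respect intertwining. Only the symbol theta_A is given, not the operator M_{thA},
    and this is why the defect identities are compressed to the vacuum: the vacuum part of a
    quadratic identity is its value at x minus the sum of its values at the L_i^* x. What remains
    for theta_A is the unitarity of the Julia matrix [[D_*, A], [-A^*, D]]. *)

Section HilbertSpace.
Variables (R : realType) (H : hilbertType R).
Implicit Types x y z : H.

(** Real-valued versions, so that minimisation and quadratic inequalities take place in the ordered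
    field [R], where [lra] and [nra] apply. *)
Definition nsq x : R := complex.Re (inner x x).
Definition rip x y : R := complex.Re (inner x y).

Lemma inner_nsq x : inner x x = (nsq x)%:C%C.
Proof. by rewrite /nsq RRe_real// ger0_real// inner_ge0. Qed.

Lemma nsq_ge0 x : 0 <= nsq x.
Proof. by rewrite -lecR -inner_nsq inner_ge0. Qed.

Lemma ripC x y : rip x y = rip y x.
Proof. by rewrite /rip innerC re_conj. Qed.

Lemma nsqD x y : nsq (x + y) = nsq x + nsq y + 2 * rip x y.
Proof.
rewrite /nsq innerDl !innerDr !re_complexD -!/(rip _ _) (ripC y x); ring.
Qed.

Lemma ripNr x y : rip x (- y) = - rip x y.
Proof.
rewrite /rip -scaleN1r innerZr rmorphN1 mulN1r.
by case: (inner x y).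
Qed.

Lemma nsqN x : nsq (- x) = nsq x.
Proof. by rewrite /nsq -scaleN1r innerZl innerZr rmorphN1 mulrA mulrNN mul1r mul1r. Qed.

Lemma nsqZ (a : R) x : nsq (a%:C%C *: x) = a ^+ 2 * nsq x.
Proof.
rewrite /nsq innerZl innerZr inner_nsq conj_complexE conjc_real.
by rewrite -!rmorphM/=; ring.
Qed.

Lemma ripZr (a : R) x y : rip x (a%:C%C *: y) = a * rip x y.
Proof.
rewrite /rip innerZr conj_complexE conjc_real re_complexM/=.
by rewrite mul0r subr0.
Qed.

Lemma nsq_norm x : nsq x = (complex.Re `|x|) ^+ 2.
Proof.
apply: complexI; rewrite -inner_nsq inner_norm rmorphXn/= RRe_real//.
exact: normr_real.
Qed.

Lemma ripDr x y z : rip x (y + z) = rip x y + rip x z.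
Proof. by rewrite /rip innerDr re_complexD. Qed.

Lemma rip_young (t : R) x y : 0 < t -> 2 * rip x y <= t * nsq x + t^-1 * nsq y.
Proof.
move=> t0; have := nsq_ge0 (t%:C%C *: x - y).
rewrite nsqD nsqN ripNr ripC ripZr nsqZ ripC => h.
rewrite -(ler_pM2l t0) mulrDr !mulrA divff ?gt_eqF// mul1r.
move: h; lra.
Qed.

Lemma innerBl x y z : inner (x - y) z = inner x z - inner y z.
Proof. by rewrite innerDl -scaleN1r innerZl mulN1r. Qed.

Lemma innerBr x y z : inner x (y - z) = inner x y - inner x z.
Proof. by rewrite innerDr -scaleN1r innerZr rmorphN1 mulN1r. Qed.

Lemma innerNl x y : inner (- x) y = - inner x y.
Proof. by rewrite -[- x]add0r innerBl inner0l sub0r. Qed.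

Lemma innerNr x y : inner x (- y) = - inner x y.
Proof. by rewrite -[- y]add0r innerBr inner0r sub0r. Qed.

Lemma inner_suml I (r : seq I) (P : pred I) (F : I -> H) y :
  inner (\sum_(i <- r | P i) F i) y = \sum_(i <- r | P i) inner (F i) y.
Proof.
apply: (big_morph (fun x => inner x y)); first by move=> ? ?; exact: innerDl.
exact: inner0l.
Qed.

Lemma inner_extl x y : (forall z, inner x z = inner y z) -> x = y.
Proof.
move=> xy; apply/eqP; rewrite -subr_eq0; apply/eqP/inner_eq0.
by rewrite innerBl xy subrr.
Qed.

Lemma inner_extr x y : (forall z, inner z x = inner z y) -> x = y.
Proof. by move=> xy; apply: inner_extl => z; rewrite innerC xy -innerC. Qed.

End HilbertSpace.

Lemma real_archi (R : realType) (e : R) : 0 < e -> exists n, n.+1%:R^-1 < e.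
Proof.
move=> e0; exists (Num.truncn e^-1).
by rewrite invf_plt ?posrE// truncnS_gt.
Qed.

Section Riesz.
Variables (R : realType) (G : lmodType R[i]) (H : hilbertType R).
Variables (f : {linear G -> H}) (phi : G -> R[i]) (c : R[i]).
Hypothesis phiP : forall a x y, phi (a *: x + y) = a * phi x + phi y.
Hypothesis c0 : 0 <= c.
Hypothesis phi_le : forall x, `|phi x| <= c * `|f x|.

Let rphi x : R := complex.Re (phi x).
Let F x : R := nsq (f x) - 2 * rphi x.

Let phi0 : phi 0 = 0.
Proof. by have := phiP (-1) 0 0; rewrite scaler0 addr0 mulN1r addNr. Qed.

Let rphiD x y : rphi (x + y) = rphi x + rphi y.
Proof. by rewrite /rphi -{1}(scale1r x) phiP mul1r re_complexD. Qed.

Let rphiZ (a : R) x : rphi (a%:C%C *: x) = a * rphi x.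
Proof.
by rewrite /rphi -[_ *: x]addr0 phiP phi0 addr0 re_complexM/= mul0r subr0.
Qed.

Let F_ge x : - (complex.Re c) ^+ 2 <= F x.
Proof.
rewrite /F nsq_norm; set n := complex.Re `|_|; set r := complex.Re c.
suff : `|rphi x| <= r * n.
  move=> /ler_normlP[_ h]; have := sqr_ge0 (n - r); move: h; nra.
rewrite -lecR (le_trans (normc_ge_Re _))// (le_trans (phi_le x))//.
by rewrite rmorphM/= !RRe_real ?normr_real// ger0_real.
Qed.

Let A : set R := range F.

Let A_inf : has_inf A.
Proof.
split; first by exists (F 0), 0.
by exists (- (complex.Re c) ^+ 2) => _ [x _ <-]; exact: F_ge.
Qed.

Let m := inf A.

Let mF x : m <= F x.
Proof. by apply: ge_inf; [exact: A_inf.2|exists x]. Qed.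

(** The parallelogram law gives |f x - f y|^2 = 2 F(x) + 2 F(y) - 4 F((x + y)/2). Hence the images
    under [f] of a minimising sequence are Cauchy, although [G] itself carries no norm. *)
Let parallelogram x y : nsq (f x - f y) <= 2 * (F x - m) + 2 * (F y - m).
Proof.
have := mF ((2^-1)%:C%C *: (x + y)).
rewrite /F linearZ/= linearD/= nsqZ rphiZ rphiD !nsqD ripNr nsqN.
rewrite (_ : 2^-1 ^+ 2 = 4^-1); last by field.
move: (nsq _) (nsq _) (rip _ _) (rphi _) (rphi _) m => a1 a2 a3 a4 a5 a6; lra.
Qed.

(** The representing vector is the limit of [f] along a sequence minimising [F], so it lies in the
    closure of the range of [f]. With [f] the identity this is the usual Riesz theorem. *)
Lemma generalized_riesz : exists u, (forall x, phi x = inner (f x) u) /\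
  (forall e : R[i], 0 < e -> exists x, `|f x - u| < e).
Proof.
have /choice[v vm] : forall n, exists x, F x < m + n.+1%:R^-1.
  move=> n; have [|_ [x _ <-] xm] := @inf_adherent _ A (n.+1%:R^-1) _ A_inf.
    by rewrite invr_gt0 ltr0n.
  by exists x.
have small n N : (N <= n)%N -> n.+1%:R^-1 <= N.+1%:R^-1 :> R.
  by move=> Nn; rewrite lef_pV2 ?posrE ?ltr0n// ler_nat.
have [|u fu] := @inner_complete _ _ (f \o v).
  move=> e e0; have eE : e = (complex.Re e)%:C%C by rewrite RRe_real// gtr0_real.
  have re0 : 0 < complex.Re e by rewrite -ltcR -eE.
  have [|N Ne] := @real_archi _ (complex.Re e / 4); first by rewrite divr_gt0.
  exists N => k l Nk Nl; rewrite inner_nsq eE ltcR/=.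
  rewrite (le_lt_trans (parallelogram _ _))//.
  have := vm k; have := vm l; have := small _ _ Nk; have := small _ _ Nl.
  move: Ne; move: (k.+1%:R^-1) (l.+1%:R^-1) (N.+1%:R^-1) => r1 r2 r3.
  move: (F (v k)) (F (v l)) m (complex.Re e) => r4 r5 r6 r7; lra.
have {}fu (e : R) : 0 < e -> exists N, forall n, (N <= n)%N -> nsq (f (v n) - u) < e.
  move=> e0; have [|N Ne] := fu e%:C%C; first by rewrite -[0]/(0%:C%C) ltcR.
  by exists N => n Nn; rewrite -ltcR -inner_nsq Ne.
exists u; split; last first.
  move=> e e0; have eE : e = (complex.Re e)%:C%C by rewrite RRe_real// gtr0_real.
  have re0 : 0 < complex.Re e by rewrite -ltcR -eE.
  have [|N Ne] := fu ((complex.Re e) ^+ 2); first by rewrite exprn_gt0.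
  exists (v N); rewrite -(@ltr_pXn2r _ 2) ?nnegrE ?(ltW e0)//.
  by rewrite -inner_norm inner_nsq eE -rmorphXn ltcR Ne.
(* First variation: [m <= F (v n + s y)] is taken to the limit in [n], which replaces [f (v n)] by
   [u]. *)
have var y (s : R) : 0 <= 2 * s * (rip (f y) u - rphi y) + s ^+ 2 * nsq (f y).
  rewrite -[leRHS]addr0; apply/ler_addgt0Pr => e e0; rewrite addr0.
  pose b := s ^+ 2 * nsq (f y).
  have b0 : 0 <= b by rewrite mulr_ge0 ?sqr_ge0 ?nsq_ge0.
  (* The cross term with [f (v n) - u] is split by Young's inequality. The parameter [t] keeps the
     part with [s f y] below [e / 4]; then [n] is taken so large that the other part is below
     [e / 4] too. *)
  have [t t0 tb] : exists2 t : R, 0 < t & t * b <= e / 4.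
    have b1 : 0 < b + 1 by rewrite ltr_wpDl.
    exists (e / (4 * (b + 1))); first by rewrite divr_gt0// mulr_gt0.
    rewrite mulrAC ler_pdivrMr ?mulr_gt0//.
    rewrite (_ : e / 4 * _ = e * b + e); last by field.
    by rewrite lerDl ltW.
  have [|N Ne] := fu (t * e / 4); first by rewrite divr_gt0// mulr_gt0.
  have [|N' N'e] := @real_archi _ (e / 4); first by rewrite divr_gt0.
  pose n := maxn N N'.
  have fvn := Ne n (leq_maxl _ _).
  have n1 := small _ _ (leq_maxr N N' : (N' <= n)%N).
  have FE : F (v n + s%:C%C *: y) = F (v n) +
      2 * s * (rip (f y) (f (v n)) - rphi y) + b.
    rewrite /F linearD linearZ/= rphiD rphiZ nsqD nsqZ ripZr ripC /b.
    ring.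
  have := mF (v n + s%:C%C *: y); have := vm n; rewrite FE.
  have := rip_young (s%:C%C *: f y) (f (v n) - u) t0.
  rewrite nsqZ ripC ripZr ripC ripDr ripNr -/b.
  have : t^-1 * nsq (f (v n) - u) < e / 4.
    by rewrite mulrC ltr_pdivrMr// mulrC mulrA.
  clearbody b; clear b0 FE; move: tb N'e n1; move: (rphi y) m b (F _) => r1 r2 r3 r4.
  move: (rip _ _) (rip _ _) (n.+1%:R^-1) (N'.+1%:R^-1) => r5 r6 r7 r8.
  move: (t^-1 * _) (t * _) => r9 r10; move: e0; lra.
have key y : rip (f y) u = rphi y.
  apply/eqP; rewrite -subr_eq0; move: (var y).
  set a := rip _ _ - _; set b := nsq _ => ab; apply/eqP.
  have b0 : 0 < b + 1 by rewrite ltr_wpDl ?nsq_ge0.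
  (* Nearly the minimiser [- a / b] of 2 s a + s^2 b; the [+ 1] covers [b = 0]. The value there is
     strictly negative unless [a = 0]. *)
  have := ab (- a / (b + 1)); rewrite exprMn exprVn.
  have -> : 2 * (- a / (b + 1)) * a + (- a) ^+ 2 / (b + 1) ^+ 2 * b =
     - (a ^+ 2 * (b + 2)) / (b + 1) ^+ 2 by field; rewrite gt_eqF.
  rewrite mulNr oppr_ge0 => h; apply/eqP; rewrite -sqrf_eq0 eq_le sqr_ge0 andbT.
  move: h; rewrite pmulr_lle0 ?invr_gt0 ?exprn_gt0// pmulr_lle0//.
  by rewrite ltr_wpDl ?nsq_ge0.
move=> x; apply/eqP; rewrite eq_complex; apply/andP; split; apply/eqP.
  exact: esym (key x).
(* Imaginary parts are the real identity at [i x]. *)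
have := key ('i%C *: x); rewrite /rphi -[_ *: x]addr0 phiP phi0 !addr0.
rewrite /rip linearZ/= innerZl.
by case: (inner _ u) (phi x) => [? ?] [? ?] /=; rewrite !mul0r !mul1r !sub0r => /oppr_inj.
Qed.
End Riesz.

(** * Adjoints and isometric extensions *)

Section Adjoint.
Variable R : realType.
Implicit Types H K L : hilbertType R.

Lemma bounded_op_of H K (f : H -> K) : linear f ->
  (exists M : R[i], forall x, `|f x| <= M * `|x|) ->
  exists F : 'B(H, K), forall x, F x = f x.
Proof.
move=> lf bf.
pose l := @GRing.isLinear.Build R[i] H K _ f lf.
pose b := isBoundedOp.Build R H K f bf.
pose F : 'B(H, K) := HB.pack f l b.
by exists F.
Qed.

Lemma adj_exists H K (T : 'B(H, K)) :
  exists S : 'B(K, H), forall x y, inner (T x) y = inner x (S y).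
Proof.
have [M M0 TM] := op_boundedE T.
have /choice[S TS] : forall y, exists u, forall x, inner (T x) y = inner x u.
  move=> y.
  have [|||u [uP _]] := @generalized_riesz _ H H (idfun : {linear H -> H})
    (fun x => inner (T x) y) (M * `|y|).
  - by move=> a x z; rewrite linearP innerDl innerZl.
  - by rewrite mulr_ge0.
  - move=> x /=; rewrite (le_trans (cauchy_schwarz _ _))// mulrAC.
    by rewrite ler_wpM2r.
  by exists u.
have [||F FS] := @bounded_op_of K H S.
- move=> a y z; apply: inner_extr => x.
  by rewrite -TS !innerDr !innerZr !TS.
- exists M => y; have [->|Sy] := eqVneq (S y) 0; first by rewrite normr0 mulr_ge0.
  rewrite -(@ler_pM2r _ `|S y|) ?normr_gt0// -expr2 -inner_norm -TS.
  rewrite -[leLHS]ger0_norm ?TS ?inner_ge0// -TS (le_trans (cauchy_schwarz _ _))//.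
  by rewrite mulrAC ler_wpM2r.
by exists F => x y; rewrite FS.
Qed.

Lemma adjP H K (T : 'B(H, K)) x y : inner (T x) y = inner x (adj T y).
Proof.
exact: (@xgetPex 'B(K, H) \0 (fun S : 'B(K, H) =>
  forall x y, inner (T x) y = inner x (S y)) (adj_exists T) x y).
Qed.

Lemma adjPl H K (T : 'B(H, K)) x y : inner (adj T x) y = inner x (T y).
Proof. by rewrite innerC -adjP -innerC. Qed.

Lemma adj_eq H K (T : 'B(H, K)) y z :
  (forall x, inner (T x) y = inner x z) -> adj T y = z.
Proof. by move=> Tz; apply: inner_extr => x; rewrite -adjP. Qed.

Lemma adjK H K (T : 'B(H, K)) x : adj (adj T) x = T x.
Proof. by apply: adj_eq => y; rewrite adjPl. Qed.

Lemma adj_comp H K L (S : 'B(K, L)) (T : 'B(H, K)) y :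
  adj (S \o T) y = adj T (adj S y).
Proof. by apply: adj_eq => x /=; rewrite !adjP. Qed.

Lemma adj_ext H K (S T : 'B(H, K)) : (forall x, S x = T x) ->
  forall y, adj S y = adj T y.
Proof. by move=> ST y; apply: adj_eq => x; rewrite ST adjP. Qed.

Lemma unitary_inner H K (U : 'B(H, K)) : unitary U ->
  forall x y, inner (U x) (U y) = inner x y.
Proof. by move=> [UK _] x y; rewrite adjP UK. Qed.

Lemma unitary_adj H K (U : 'B(H, K)) : unitary U -> unitary (adj U).
Proof. by move=> [U1 U2]; split=> x; rewrite adjK. Qed.

(** Density of the span of the values, in the dual form that equality tests through [inner] consume
    directly. *)
Definition total_range (G : Type) H (f : G -> H) :=
  forall h, (forall x, inner (f x) h = 0) -> h = 0.

Lemma total_range_ext (G : Type) H K (f : G -> H) (S T : 'B(H, K)) : total_range f ->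
  (forall x, S (f x) = T (f x)) -> forall h, S h = T h.
Proof.
move=> tf ST h; apply: inner_extl => k; rewrite !adjP.
apply/eqP; rewrite -subr_eq0 -innerBr; apply/eqP.
rewrite (tf (_ - _)) ?inner0r// => x.
by rewrite innerBr -!adjP ST subrr.
Qed.

Lemma sub_inner H (S : closedSubspace H) (x y : subHilbert S) :
  inner x y = inner (val x) (val y).
Proof. by []. Qed.

Lemma sub_norm H (S : closedSubspace H) (x : subHilbert S) : `|x| = `|val x|.
Proof. by rewrite !inner_sqrtC. Qed.

Lemma to_crange_total H K (T : 'B(H, K)) : total_range (to_crange T).
Proof.
move=> u uT; apply: inner_eq0; apply/eqP; rewrite -normr_le0.
apply/ler_addgt0Pl => e e0; rewrite addr0.
have u1 : 0 < `|u| + 1 by rewrite ltr_wpDl.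
have /csub_memP/closure_normP/(_ (e / (`|u| + 1)))[|_ [x _ <-] xu] := valP u.
  by rewrite divr_gt0.
have -> : inner u u = inner (u - to_crange T x) u by rewrite innerBl uT subr0.
rewrite (le_trans (cauchy_schwarz _ _))//.
rewrite (@le_trans _ _ (`|u - to_crange T x| * (`|u| + 1)))//.
  by rewrite ler_wpM2l// lerDl.
by rewrite -ler_pdivlMr// ltW// sub_norm raddfB.
Qed.

Lemma injective_adj_total H K (T : 'B(H, K)) : injective T -> total_range (adj T).
Proof.
move=> Ti h Th; apply: Ti; rewrite linear0; apply: inner_extr => x.
by rewrite -adjPl Th inner0r.
Qed.

Section IsometricExtension.
Variables (G : lmodType R[i]) (H K : hilbertType R).

Lemma polarization (f : {linear G -> H}) (g : {linear G -> K}) :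
  (forall x, inner (f x) (f x) = inner (g x) (g x)) ->
  forall x y, inner (f x) (f y) = inner (g x) (g y).
Proof.
move=> fg x y; have := fg (x + y); have := fg (x + 'i%C *: y).
rewrite !linearD !linearZ/= !innerDl !innerDr !innerZl !innerZr !fg.
rewrite [inner (f y) (f x)]innerC [inner (g y) (g x)]innerC.
rewrite !conj_complexE => e1 e2.
have := congr1 (@complex.Re _) e1; have := congr1 (@complex.Re _) e2.
move: e1 e2 => _ _.
case: (inner (f x) (f y)) => a b; case: (inner (g x) (g y)) => a' b'.
case: (inner (g x) (g x)) => p q; case: (inner (g y) (g y)) => r s /= h1 h2.
congr (_ +i* _)%C; move: h1 h2; lra.
Qed.

(** [u k] is the vector representing [x |-> inner (g x) k] through [f]. This defines [u] on all of
    [K] at once, without limits along sequences [g x]. *)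
Lemma isometric_extension_half (f : {linear G -> H}) (g : {linear G -> K}) :
  (forall x, inner (f x) (f x) = inner (g x) (g x)) -> total_range f ->
  exists u : 'B(K, H), forall x, u (g x) = f x.
Proof.
move=> fg tf; have nfg x : `|g x| = `|f x| by rewrite !inner_sqrtC fg.
have /choice[u uP] : forall k, exists u, (forall x, inner (g x) k = inner (f x) u) /\
    (forall e : R[i], 0 < e -> exists x, `|f x - u| < e).
  move=> k; apply: (@generalized_riesz _ _ _ f _ `|k|) => //.
    by move=> a x y; rewrite linearP innerDl innerZl.
  by move=> x; rewrite mulrC -nfg cauchy_schwarz.
have u_eq k z : (forall x, inner (g x) k = inner (f x) z) -> u k = z.
  move=> kz; apply/eqP; rewrite -subr_eq0; apply/eqP/tf => x.
  by rewrite innerBr -(uP k).1 kz subrr.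
have [||F FS] := @bounded_op_of K H u.
- move=> a y z; apply: u_eq => x.
  by rewrite !innerDr !innerZr !(uP _).1.
- exists 1 => k; rewrite mul1r; have [->|uk] := eqVneq (u k) 0; first by rewrite normr0.
  rewrite -(@ler_pM2r _ `|u k|) ?normr_gt0// -expr2 -inner_norm.
  (* For [f x] close to [u k], |u k|^2 is nearly [inner (g x) k], which is at most |f x| |k| since
     [g x] and [f x] have equal norms. *)
  apply/ler_addgt0Pr => e e0.
  have c0 : 0 < `|u k| + `|k| + 1 by rewrite ltr_wpDl// addr_ge0.
  have [x xu] := (uP k).2 (e / (`|u k| + `|k| + 1)) (divr_gt0 e0 c0).
  have -> : inner (u k) (u k) = inner (u k - f x) (u k) + inner (g x) k.
    by rewrite (uP k).1 innerBl subrK.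
  rewrite -[leLHS]ger0_norm; last first.
    by rewrite (uP k).1 innerBl subrK inner_ge0.
  rewrite (le_trans (ler_normD _ _))//.
  rewrite (le_trans (lerD (cauchy_schwarz _ _) (cauchy_schwarz _ _)))// distrC nfg.
  have fx : `|f x| <= `|u k| + `|f x - u k|.
    by rewrite -{1}(subrK (u k) (f x)) addrC ler_normD.
  rewrite (@le_trans _ _ (`|f x - u k| * `|u k| + (`|u k| + `|f x - u k|) * `|k|))//.
    by rewrite lerD2l ler_wpM2r.
  rewrite mulrDl addrCA [`|u k| * `|k|]mulrC lerD2l -mulrDr.
  rewrite (@le_trans _ _ (`|f x - u k| * (`|u k| + `|k| + 1)))//.
    by rewrite ler_wpM2l// lerDl.
  by rewrite -ler_pdivlMr// ltW.
by exists F => x; rewrite FS; apply: u_eq => y; rewrite (polarization fg).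
Qed.

End IsometricExtension.

(** The two half extensions, [g x |-> f x] and [f x |-> g x], are inverse to each other and adjoint
    to each other. *)
Lemma isometric_extension (G : lmodType R[i]) H K (f : {linear G -> H}) (g : {linear G -> K}) :
  (forall x, inner (f x) (f x) = inner (g x) (g x)) ->
  total_range f -> total_range g ->
  exists2 v : 'B(H, K), unitary v & forall x, v (f x) = g x.
Proof.
move=> fg tf tg.
have [u ug] := isometric_extension_half fg tf.
have [v vf] := isometric_extension_half (fun x => esym (fg x)) tg.
exists v => //.
have vu k : adj v k = u k.
  apply: (@total_range_ext G _ _ g) => // x; rewrite ug.
  apply/eqP; rewrite -subr_eq0; apply/eqP/tf => y.
  by rewrite innerBr -adjP vf (polarization fg) subrr.
split=> x; rewrite vu.
  apply: (@total_range_ext G H H f (u \o v) idfun) => // y /=.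
  by rewrite vf ug.
apply: (@total_range_ext G K K g (v \o u) idfun) => // y /=.
by rewrite ug vf.
Qed.

End Adjoint.

(** * Positive square roots *)

Section Limits.
Local Open Scope classical_set_scope.
Local Open Scope ring_scope.
Variable R : realType.
Implicit Types H K : hilbertType R.

Lemma op_cvg H K (T : 'B(H, K)) (u : nat -> H) l :
  u @ \oo --> l -> (fun n => T (u n)) @ \oo --> T l.
Proof.
move=> ul; apply/cvgrPdist_lt => e e0; have [M M0 TM] := op_boundedE T.
have M1 : 0 < M + 1 by rewrite ltr_wpDl.
move/cvgrPdist_lt : ul => /(_ (e / (M + 1)) (divr_gt0 e0 M1)).
apply: filterS => n lu; rewrite -linearB (le_lt_trans (TM _))//.
rewrite (@le_lt_trans _ _ ((M + 1) * `|l - u n|))//.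
  by rewrite ler_wpM2r// lerDl.
by rewrite mulrC -ltr_pdivlMr.
Qed.

Lemma hilbert_cvg_unique H (u : nat -> H) (l k : H) :
  u @ \oo --> l -> u @ \oo --> k -> l = k.
Proof. exact: (@cvg_unique _ (@norm_hausdorff _ _)). Qed.

Lemma linear_cvg H (u v : nat -> H) (l k : H) (a : R[i]) :
  u @ \oo --> l -> v @ \oo --> k ->
  (fun n => a *: u n + v n) @ \oo --> a *: l + k.
Proof. by move=> ul vk; apply: cvgD => //; apply: cvgZ => //; exact: cvg_cst. Qed.

Lemma dominated_cvg0 H K (u : nat -> H) (v : nat -> K) :
  (forall n, `|v n| <= `|u n|) -> u @ \oo --> (0 : H) -> v @ \oo --> (0 : K).
Proof.
move=> vu /cvgrPdist_lt u0; apply/cvgrPdist_lt => e e0.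
apply: filterS (u0 e e0) => n; rewrite !sub0r !normrN; exact: le_lt_trans.
Qed.

Lemma cvg_inner_eq H K (u : nat -> H) l (v : nat -> K) k (x : H) (y : K) :
  u @ \oo --> l -> v @ \oo --> k -> (forall n, inner (u n) x = inner y (v n)) ->
  inner l x = inner y k.
Proof.
move=> ul vk uv; apply/eqP; rewrite -subr_eq0 -normr_le0.
apply/ler_addgt0Pl => e e0; rewrite addr0.
have c0 : 0 < `|x| + `|y| + 1 by rewrite ltr_wpDl// addr_ge0.
pose e1 := e / (`|x| + `|y| + 1).
have e10 : 0 < e1 by exact: divr_gt0.
move/cvgrPdist_lt : ul => /(_ e1 e10) ul.
move/cvgrPdist_lt : vk => /(_ e1 e10) vk.
have [n [nl nk]] := filter_ex (filterI ul vk).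
have -> : inner l x - inner y k = inner (l - u n) x - inner y (k - v n).
  by rewrite innerBl innerBr uv opprB addrA subrK.
rewrite (le_trans (ler_normB _ _))//.
rewrite (le_trans (lerD (cauchy_schwarz _ _) (cauchy_schwarz _ _)))//.
rewrite (@le_trans _ _ (e1 * `|x| + `|y| * e1))//.
  by rewrite lerD// ?ler_wpM2r ?ler_wpM2l// ltW.
rewrite (mulrC `|y|) -mulrDr (@le_trans _ _ (e1 * (`|x| + `|y| + 1)))//.
  by rewrite ler_wpM2l ?lerDl// ltW.
by rewrite divfK// gt_eqF.
Qed.

End Limits.

Section PositiveOperators.
Variables (R : realType) (H : hilbertType R) (T : 'B(H, H)).
Hypothesis T0 : positive T.

(** Over the complex numbers a real quadratic form already forces symmetry: polarise with [x + y]
    and [x + i y]. *)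
Lemma positive_selfadj x y : inner (T x) y = inner x (T y).
Proof.
rewrite [RHS]innerC.
have im0 z : complex.Im (inner (T z) z) = 0.
  by have := T0 z; rewrite lecE/= => /andP[/eqP].
have := im0 (x + y); have := im0 (x + 'i%C *: y).
rewrite !linearD !linearZ/= !innerDl !innerDr !innerZl !innerZr.
rewrite !conj_complexE !im_complexD.
have := im0 x; have := im0 y; move: (inner _ _) (inner _ _) => p q.
case: (inner (T x) y) => a b; case: (inner (T y) x) => c e.
case: p => p1 p2; case: q => q1 q2 /= -> -> h1 h2.
congr (_ +i* _)%C; move: h1 h2; lra.
Qed.

Lemma positive_ker y : inner (T y) y = 0 -> T y = 0.
Proof.
move=> y0; apply: inner_eq0; rewrite inner_nsq.
set p := nsq (T y); pose q := complex.Re (inner (T (T y)) (T y)).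
have q0 : 0 <= q by rewrite -lecR RRe_real ?ger0_real.
have q1 : 0 < q + 1 by rewrite ltr_wpDl.
have quad (t : R) : 0 <= - (2 * t * p) + t ^+ 2 * q.
  have := T0 (y - t%:C%C *: T y); rewrite lecE => /andP[_].
  rewrite linearB linearZ/= innerBl !innerBr y0 !innerZl !innerZr.
  rewrite [inner (T (T y)) y]positive_selfadj inner_nsq -/p conj_complexE conjc_real /q.
  by case: (inner (T (T y)) _) => q1' q2' /=; lra.
have p2 : p ^+ 2 * (q + 2) <= 0.
  (* Nearly the minimising [t = p / q], with [+ 1] to allow [q = 0]. *)
  have := quad (p / (q + 1)).
  have -> : - (2 * (p / (q + 1)) * p) + (p / (q + 1)) ^+ 2 * q =
      - (p ^+ 2 * (q + 2)) / (q + 1) ^+ 2 by field; rewrite gt_eqF.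
  by rewrite mulNr oppr_ge0 pmulr_lle0 ?invr_gt0 ?exprn_gt0.
congr (_%:C%C); apply/eqP; rewrite -sqrf_eq0 eq_le sqr_ge0 andbT.
by rewrite -(pmulr_lle0 _ (_ : 0 < q + 2))// ltr_wpDl.
Qed.

End PositiveOperators.

Section SquareRoot.
Local Open Scope classical_set_scope.
Local Open Scope ring_scope.
Variable R : realType.

(** The operator iteration below in the scalar case [X = 1]; it majorises the norms of the iterates
    and of their differences. *)
Fixpoint root_bound n : R :=
  if n is m.+1 then 2^-1 * (1 + root_bound m ^+ 2) else 0.

Lemma root_bound_ge0 n : 0 <= root_bound n.
Proof.
elim: n => //= n IHn.
by rewrite mulr_ge0 ?invr_ge0// addr_ge0// sqr_ge0.
Qed.

Lemma root_bound_le1 n : root_bound n <= 1.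
Proof.
elim: n => [|n IHn] /=; first exact: ler01.
have := root_bound_ge0 n; move: IHn; set r := root_bound n; nra.
Qed.

(** The error e = 1 - r evolves by e |-> e - e^2/2. The fixed point 1 is neutral, so no geometric
    rate is available and the decay is only of order 1/n. *)
Lemma root_bound_rate n : 1 - root_bound n <= 2 / n.+2%:R.
Proof.
elim: n => [|n IHn] /=; first by rewrite subr0 divff ?pnatr_eq0.
have := root_bound_le1 n; have := root_bound_ge0 n; move: IHn.
have n2 : 0 < n.+2%:R :> R by rewrite ltr0n.
have -> : n.+3%:R = n.+2%:R + 1 :> R by rewrite [RHS]natr1.
have : (2 : R) <= n.+2%:R by rewrite (ler_nat R 2 n.+2).
move: n2; set k := n.+2%:R => k0 k2.
set r := root_bound n; set z := 2 / k => h1 h2 h3.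
have zk : z * k = 2 by rewrite divfK// gt_eqF.
have z0 : 0 < z by rewrite divr_gt0.
have z1 : z <= 1 by nra.
rewrite ler_pdivlMr; last by rewrite addr_gt0.
have : 1 - 2^-1 * (1 + r ^+ 2) <= z - z ^+ 2 / 2 by nra.
move=> h4; apply: (@le_trans _ _ ((z - z ^+ 2 / 2) * (k + 1))).
  by apply: ler_wpM2r h4; lra.
have -> : (z - z ^+ 2 / 2) * (k + 1) = z * k + z - z * (z * k) / 2 - z ^+ 2 / 2 by ring.
by rewrite zk; nra.
Qed.

Section Iteration.
Variables (H : hilbertType R) (X : 'B(H, H)).

(* The iteration Y |-> (X + Y^2) / 2 converges to I - (I - X)^{1/2}. *)
Fixpoint root_iter n (x : H) : H :=
  if n is m.+1 then 2^-1 *: (X x + root_iter m (root_iter m x)) else 0.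

Lemma root_iter_linear n : linear (root_iter n).
Proof.
elim: n => [|n IHn] a x y /=; first by rewrite scaler0 addr0.
rewrite linearP !IHn addrACA -scalerDr.
by rewrite [LHS]scalerDr !scalerA [_ * a]mulrC.
Qed.

Lemma root_iterB n x y : root_iter n (x - y) = root_iter n x - root_iter n y.
Proof.
have := root_iter_linear n (-1) y x.
by rewrite !scaleN1r [- y + x]addrC [- root_iter n y + _]addrC.
Qed.

Hypothesis X1 : contractive X.

Lemma root_iter_le n x : `|root_iter n x| <= (root_bound n)%:C%C * `|x|.
Proof.
elim: n x => [|n IHn] x /=; first by rewrite normr0 mul0r.
rewrite normrZ ger0_norm ?invr_ge0//.
rewrite rmorphM/= fmorphV rmorph_nat -mulrA ler_wpM2l ?invr_ge0//.
rewrite (le_trans (ler_normD _ _))// rmorphD rmorph1 mulrDl mul1r lerD//.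
rewrite (le_trans (IHn _))// rmorphXn expr2 -mulrA ler_wpM2l//.
by rewrite -[0]/(0%:C%C) lecR root_bound_ge0.
Qed.

(** Majorant argument: Ym^2 - Yn^2 = Ym (Ym - Yn) + (Ym - Yn) Yn holds without commutation, and the
    same splitting of the scalar bounds is exact, so operator increments stay below scalar
    increments. *)
Lemma root_iter_dist n k x :
  `|root_iter (n + k) x - root_iter n x| <=
  (root_bound (n + k) - root_bound n)%:C%C * `|x|.
Proof.
elim: n x => [|n IHn] x; first by rewrite subr0 subr0 root_iter_le.
rewrite addSn /= -scalerBr normrZ ger0_norm ?invr_ge0//.
rewrite opprD addrACA subrr add0r.
set Ym := root_iter (n + k); set Yn := root_iter n.
set ym := root_bound (n + k); set yn := root_bound n.
have -> : 2^-1 * (1 + ym ^+ 2) - 2^-1 * (1 + yn ^+ 2) =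
  2^-1 * (ym * (ym - yn) + (ym - yn) * yn) by ring.
rewrite rmorphM/= fmorphV rmorph_nat -mulrA ler_wpM2l ?invr_ge0//.
have -> : Ym (Ym x) - Yn (Yn x) = Ym (Ym x - Yn x) + (Ym (Yn x) - Yn (Yn x)).
  by rewrite /Ym root_iterB addrA subrK.
rewrite (le_trans (ler_normD _ _))// rmorphD mulrDl lerD//.
  rewrite (le_trans (root_iter_le _ _))// rmorphM -mulrA ler_wpM2l//.
  by rewrite -[0]/(0%:C%C) lecR root_bound_ge0.
rewrite (le_trans (IHn _))// rmorphM -mulrA ler_wpM2l ?root_iter_le//.
rewrite -[0]/(0%:C%C) lecR subr_ge0.
elim: (n) => [|j IHj] /=; first exact: root_bound_ge0.
by rewrite ler_pM2l ?invr_gt0// lerD2l lerXn2r ?nnegrE ?root_bound_ge0.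
Qed.

Lemma root_iter_rate N n x : (N <= n)%N ->
  `|root_iter n x - root_iter N x| <= 2 * N.+1%:R^-1 * `|x|.
Proof.
move=> /subnKC <-; rewrite (le_trans (root_iter_dist _ _ _))//.
rewrite ler_wpM2r// -[2](rmorph_nat (real_complex R)) -(rmorph_nat (real_complex R)).
rewrite -fmorphV -rmorphM lecR.
have le2 : 2 / N.+2%:R <= 2 / N.+1%:R :> R.
  by rewrite ler_pM2l// lef_pV2 ?posrE ?ltr0n// ler_nat.
have := root_bound_rate N; have := root_bound_le1 (N + (n - N)).
by move: le2; set u := 2 / _; set v := 2 / _; lra.
Qed.

Lemma root_iter_cvg x : exists l : H, (fun n => root_iter n x) @ \oo --> l.
Proof.
have [|l xl] := @cauchy_seq_cvg R H (root_iter^~ x).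
  move=> e e0.
  have x1 : 0 < `|x| + 1 by rewrite ltr_wpDl.
  have [N Ne] := complex_archi (divr_gt0 e0 (mulr_gt0 (ltr0Sn _ 3) x1)).
  have dist n : (N <= n)%N -> `|root_iter n x - root_iter N x| < e / 2.
    move=> Nn; rewrite (le_lt_trans (root_iter_rate _ Nn))//.
    rewrite (@le_lt_trans _ _ (2 * N.+1%:R^-1 * (`|x| + 1)))//.
      by rewrite ler_wpM2l ?lerDl ?mulr_ge0 ?invr_ge0 ?ler0n ?ler01.
    rewrite ltr_pdivlMr//; move: Ne; rewrite ltr_pdivlMr ?mulr_gt0//.
    by congr (_ < _); ring.
  exists N => n k Nn Nk.
  rewrite -(subrK (root_iter N x) (root_iter n x)) -addrA (splitr e).
  by rewrite (le_lt_trans (ler_normD _ _))// ltrD ?dist// distrC dist.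
exists l; apply/cvgrPdist_lt => e e0; have [N Ne] := xl e e0.
by exists N => // n /= Nn; rewrite distrC Ne.
Qed.

End Iteration.

(** Every iterate is a polynomial in [X], so an intertwiner of [X1] and [X2] passes to it and then,
    in the limit, to the square roots. *)
Lemma root_iter_intertwine (H K : hilbertType R) (X1 : 'B(H, H)) (X2 : 'B(K, K))
  (Z : 'B(H, K)) : (forall x, Z (X1 x) = X2 (Z x)) ->
  forall n x, Z (root_iter X1 n x) = root_iter X2 n (Z x).
Proof.
move=> ZX; elim=> [|n IHn] x /=; first by rewrite linear0.
by rewrite linearZ linearD/= ZX !IHn.
Qed.

Section Root.
Variables (H : hilbertType R) (X : 'B(H, H)).
Hypothesis X_contractive : contractive X.
Hypothesis X_selfadj : forall x y, inner (X x) y = inner x (X y).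

Lemma root_iter_selfadj n x y :
  inner (root_iter X n x) y = inner x (root_iter X n y).
Proof.
elim: n x y => [|n IHn] x y /=; first by rewrite inner0l inner0r.
rewrite innerZl innerZr innerDl innerDr X_selfadj !IHn.
by rewrite fmorphV/= conjC_nat.
Qed.

Lemma root_exists : exists Y : 'B(H, H),
  [/\ forall x, (fun n => root_iter X n x) @ \oo --> Y x,
      positive (idfun \- Y) & forall x, (idfun \- Y) ((idfun \- Y) x) = x - X x].
Proof.
have /choice[Y0 Y0P] := root_iter_cvg X_contractive.
have Y0l : linear Y0.
  move=> a x y; apply: hilbert_cvg_unique (Y0P _) _.
  under eq_fun do rewrite root_iter_linear.
  exact: linear_cvg.
have Y0c x : `|Y0 x| <= `|x|.
  apply/ler_addgt0Pr => e e0.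
  move/cvgrPdist_lt : (Y0P x) => /(_ e e0)/filter_ex[n xn].
  rewrite -(subrK (root_iter X n x) (Y0 x)) (le_trans (ler_normD _ _))//.
  rewrite [leLHS]addrC lerD//; last exact: ltW.
  rewrite (le_trans (root_iter_le X_contractive _ _))//.
  rewrite -[leRHS]mul1r ler_wpM2r// -[1]/(1%:C%C) lecR; exact: root_bound_le1.
have [|Y YE] := @bounded_op_of R H H Y0 Y0l.
  by exists 1 => x; rewrite mul1r.
have {}Y0P x : (fun n => root_iter X n x) @ \oo --> Y x by rewrite YE.
have Yc x : `|Y x| <= `|x| by rewrite YE.
have Ys x y : inner (Y x) y = inner x (Y y).
  by apply: cvg_inner_eq (Y0P x) (Y0P y) _ => n; exact: root_iter_selfadj.
(* The limit of the recursion; it says (I - Y)^2 = I - 2 Y + Y^2 = I - X. *)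
have YY x : Y (Y x) = 2 *: Y x - X x.
  pose u n := root_iter X n (root_iter X n x).
  have u1 : u @ \oo --> 2 *: Y x - X x.
    have -> : u = (fun n => 2 *: root_iter X n.+1 x + (- X x)).
      apply/funext => n /=; rewrite scalerA divff ?pnatr_eq0// scale1r.
      by rewrite addrAC subrr add0r.
    apply: linear_cvg; last exact: cvg_cst.
    by rewrite (cvg_shiftS (fun n => root_iter X n x)).
  (* Both factors of Y_n Y_n x move with [n]; the iterates are uniformly contractive, so Y_n (Y_n x
     - Y x) tends to 0. *)
  have u2 : u @ \oo --> Y (Y x).
    have -> : u = (fun n => root_iter X n (root_iter X n x - Y x) + root_iter X n (Y x)).
      by apply/funext => n; rewrite root_iterB subrK.
    rewrite -[Y (Y x)]add0r; apply: cvgD => //.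
    apply: (@dominated_cvg0 _ _ _ (fun n => root_iter X n x - Y x)) => [n|].
      rewrite (le_trans (root_iter_le X_contractive _ _))//.
      rewrite -[leRHS]mul1r ler_wpM2r// -[1]/(1%:C%C) lecR; exact: root_bound_le1.
    by rewrite -(subrr (Y x)); apply: cvgB => //; exact: cvg_cst.
  exact: hilbert_cvg_unique u2 u1.
exists Y; split => // x /=; last first.
  rewrite linearB/= YY scaler_nat mulr2n; move: (Y x) (X x) => y z.
  by rewrite opprB [y + y - z - y]addrAC addrK addrA subrK.
have := cauchy_schwarz (Y x) x.
rewrite innerBl => YX.
rewrite subr_ge0 (le_trans (real_ler_norm _))//; first by rewrite CrealE -innerC Ys.
by rewrite (le_trans YX)// inner_norm expr2 ler_wpM2r.
Qed.

End Root.
End SquareRoot.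

Section PositiveRoot.
Local Open Scope classical_set_scope.
Local Open Scope ring_scope.
Variable R : realType.
Implicit Types H K : hilbertType R.

Lemma psqrt_positive H (T : 'B(H, H)) : positive (psqrt T).
Proof.
rewrite /psqrt; case: xgetP => [S _ []//|_ x].
by rewrite inner0l.
Qed.

Lemma psqrt_root H (X : 'B(H, H)) : contractive X ->
  (forall x y, inner (X x) y = inner x (X y)) ->
  forall x, psqrt (idfun \- X) (psqrt (idfun \- X) x) = x - X x.
Proof.
move=> X1 Xs; have [Y [_ Y0 YY]] := root_exists X1 Xs.
have ex : exists S : 'B(H, H), positive S /\ forall x, S (S x) = (idfun \- X) x.
  by exists (idfun \- Y).
exact: (@xgetPex 'B(H, H) \0 (fun S : 'B(H, H) =>
  positive S /\ forall x, S (S x) = (idfun \- X) x) ex).2.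
Qed.

(** Uniqueness of the positive root, which identifies the chosen [psqrt] with Q = I - Y. A positive
    root S commutes with X = I - S^2, hence with Q, and (S + Q)(S - Q) = 0. Positivity then makes S
    and Q both vanish on E = (S - Q) x, so |E|^2 = 0. *)
Lemma psqrt_cvg H (X : 'B(H, H)) : contractive X ->
  (forall x y, inner (X x) y = inner x (X y)) ->
  forall x, (fun n => root_iter X n x) @ \oo --> x - psqrt (idfun \- X) x.
Proof.
move=> X1 Xs x; have [Y [Yl Q0 QQ]] := root_exists X1 Xs.
suff -> : psqrt (idfun \- X) x = x - Y x by rewrite subKr.
have S0 := psqrt_positive (idfun \- X); have SS := psqrt_root X1 Xs.
move: (psqrt (idfun \- X)) S0 SS => S S0 SS.
have SX y : S (X y) = X (S y).
  have XE z : X z = z - S (S z) by rewrite SS subKr.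
  by rewrite !XE linearB.
have SY y : S (Y y) = Y (S y).
  apply: hilbert_cvg_unique _ (Yl (S y)).
  under eq_fun do rewrite -(root_iter_intertwine SX).
  exact: op_cvg.
have [Q [QE {}Q0 {}QQ]] : exists Q : 'B(H, H),
    [/\ forall z, Q z = z - Y z, positive Q & forall z, Q (Q z) = z - X z].
  by exists (idfun \- Y).
pose E z := S z - Q z.
have SQ z : S (Q z) = Q (S z) by rewrite !QE -SY linearB.
have SE z : S (E z) = - Q (E z).
  by rewrite /E (raddfB S) (raddfB Q)/= opprB SS SQ QQ.
have zero z : S (E z) = 0 /\ Q (E z) = 0.
  have e0 : inner (S (E z)) (E z) + inner (Q (E z)) (E z) = 0.
    by rewrite -innerDl SE addNr inner0l.
  move/eqP: e0; rewrite paddr_eq0 ?S0 ?Q0// => /andP[/eqP s0 /eqP q0].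
  by split; apply: positive_ker.
suff : E x = 0 by move/eqP; rewrite subr_eq0 QE => /eqP.
apply: inner_eq0; rewrite {1}/E innerBl (positive_selfadj S0) (positive_selfadj Q0).
by have [-> ->] := zero x; rewrite !inner0r subrr.
Qed.

Lemma psqrt_intertwine H K (X1 : 'B(H, H)) (X2 : 'B(K, K)) (Z : 'B(H, K)) :
  contractive X1 -> (forall x y, inner (X1 x) y = inner x (X1 y)) ->
  contractive X2 -> (forall x y, inner (X2 x) y = inner x (X2 y)) ->
  (forall x, Z (X1 x) = X2 (Z x)) ->
  forall x, Z (psqrt (idfun \- X1) x) = psqrt (idfun \- X2) (Z x).
Proof.
move=> c1 s1 c2 s2 ZX x.
suff : Z (x - psqrt (idfun \- X1) x) = Z x - psqrt (idfun \- X2) (Z x).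
  by rewrite linearB => /addrI/oppr_inj.
apply: (@hilbert_cvg_unique _ K (fun n => root_iter X2 n (Z x)));
  last exact: psqrt_cvg.
under eq_fun do rewrite -(root_iter_intertwine ZX).
by apply: op_cvg; exact: psqrt_cvg.
Qed.

Lemma adj_contractive H K (T : 'B(H, K)) : contractive T -> contractive (adj T).
Proof.
move=> T1 y; have [->|Ty] := eqVneq (adj T y) 0; first by rewrite normr0.
rewrite -(@ler_pM2r _ `|adj T y|) ?normr_gt0// -expr2 -inner_norm.
have -> : inner (adj T y) (adj T y) = `|inner (T (adj T y)) y|.
  by rewrite (adjP T) ger0_norm// inner_ge0.
rewrite (le_trans (cauchy_schwarz _ _))//.
by rewrite mulrC ler_wpM2l.
Qed.

Section Defect.
Variables (H K : hilbertType R) (T : 'B(H, K)).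
Hypothesis T1 : contractive T.

Let c1 : contractive (adj T \o T).
Proof. by move=> x; rewrite (le_trans (adj_contractive T1 _)). Qed.

Let s1 x y : inner ((adj T \o T) x) y = inner x ((adj T \o T) y).
Proof. by rewrite /= adjPl adjP. Qed.

Let c2 : contractive (T \o adj T).
Proof. by move=> x; rewrite (le_trans (T1 _))// adj_contractive. Qed.

Let s2 x y : inner ((T \o adj T) x) y = inner x ((T \o adj T) y).
Proof. by rewrite /= adjP adjPl. Qed.

Lemma defectK x : defect T (defect T x) = x - adj T (T x).
Proof. exact: psqrt_root c1 s1 x. Qed.

Lemma codefectK x : codefect T (codefect T x) = x - T (adj T x).
Proof. exact: psqrt_root c2 s2 x. Qed.

Lemma defect_intertwine x : T (defect T x) = codefect T (T x).
Proof. exact: psqrt_intertwine. Qed.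

Lemma defect_intertwine_adj x : adj T (codefect T x) = defect T (adj T x).
Proof. exact: psqrt_intertwine. Qed.

End Defect.

Lemma defect_selfadj H K (T : 'B(H, K)) x y :
  inner (defect T x) y = inner x (defect T y).
Proof. exact/positive_selfadj/psqrt_positive. Qed.

Lemma codefect_selfadj H K (T : 'B(H, K)) x y :
  inner (codefect T x) y = inner x (codefect T y).
Proof. exact/positive_selfadj/psqrt_positive. Qed.

Lemma inner_defect H K (T : 'B(H, K)) : contractive T -> forall x y,
  inner (defect T x) (defect T y) = inner x y - inner (T x) (T y).
Proof. by move=> T1 x y; rewrite defect_selfadj defectK// innerBr -adjP. Qed.

Lemma inner_codefect H K (T : 'B(H, K)) : contractive T -> forall x y,
  inner (codefect T x) (codefect T y) = inner x y - inner (adj T x) (adj T y).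
Proof. by move=> T1 x y; rewrite codefect_selfadj codefectK// innerBr -adjPl. Qed.

End PositiveRoot.

(** * Fock space and multi-analytic operators *)

Section FockSpace.
Local Open Scope classical_set_scope.
Local Open Scope ring_scope.
Variables (R : realType) (d : nat).
Implicit Types H K : hilbertType R.

Lemma fock_ext H (x y : fock d H) : (forall w, val x w = val y w) -> x = y.
Proof. by move=> xy; apply/val_inj/funext. Qed.

Lemma fock_valD H (x y : fock d H) w : val (x + y) w = val x w + val y w.
Proof. by rewrite raddfD. Qed.

Lemma fock_val_sum H I (r : seq I) (P : pred I) (F : I -> fock d H) w :
  val (\sum_(i <- r | P i) F i) w = \sum_(i <- r | P i) val (F i) w.
Proof.
apply: (big_morph (fun x : fock d H => val x w)); last by rewrite raddf0.
by move=> x y; exact: fock_valD.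
Qed.

Lemma limn_series_shift (u v : nat -> R) : u 0%N = 0 ->
  (forall k, u k.+1 = v k) -> limn (series u) = limn (series v).
Proof.
(* [lim] chooses an element of the set of limits, so it suffices that both series have the same set
   of limits. *)
move=> u0 uv; rewrite /lim; congr (get _); apply/seteqP.
have E : [sequence series u n.+1]_n = series v.
  apply/funext => n; rewrite /series/= big_nat_recl//= u0 add0r.
  by apply: eq_bigr => k _; rewrite uv.
by split=> l /=; rewrite -E cvg_shiftS.
Qed.

Lemma limn_series_first (u : nat -> R) :
  (forall k, u k.+1 = 0) -> limn (series u) = u 0%N.
Proof.
move=> uS; apply: cvg_lim => //; rewrite -cvg_shiftS.
rewrite (_ : [sequence _]_n = fun=> u 0%N); first exact: cvg_cst.
by apply/funext => n; rewrite /series/= big_nat_recl//= big1 ?addr0.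
Qed.

Lemma level_innerS H k (x y : seq 'I_d -> H) : level_inner k.+1 x y =
  \sum_(i < d) level_inner k (fun w => x (i :: w)) (fun w => y (i :: w)).
Proof.
rewrite /level_inner.
rewrite (reindex (fun p : 'I_d * k.-tuple 'I_d => cons_tuple p.1 p.2))/=.
  by rewrite pair_big.
exists (fun w : k.+1.-tuple 'I_d => (thead w, behead_tuple w)) => /=.
  by case=> j v _ /=; congr pair; exact: val_inj.
by move=> w _; rewrite [RHS]tuple_eta; exact: val_inj.
Qed.

Lemma level_inner0 H (x y : seq 'I_d -> H) : level_inner 0 x y = inner (x [::]) (y [::]).
Proof.
rewrite /level_inner (bigD1 [tuple])//= big1 ?addr0// => w.
by move=> /eqP[]; exact: tuple0.
Qed.

Lemma inner_fock_vac H (h : H) (x : fock d H) :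
  inner (fock_vac d h) x = inner h (val x [::]).
Proof.
have lS k : level_inner k.+1 (val (fock_vac d h)) (val x) = 0.
  by rewrite level_innerS big1// => i _; rewrite /level_inner big1// => w _; exact: inner0l.
rewrite [LHS]/inner/= /fock_inner !limn_series_first; last 2 first.
- by move=> k; rewrite lS.
- by move=> k; rewrite lS.
by rewrite level_inner0/=; case: (inner _ _).
Qed.

Lemma shift_summable H i (x : fock d H) :
  (fun w => val x (i :: w)) \in @square_summable R d H.
Proof.
apply: (@square_summable_bounded _ _ _ _ (fock_normsq x)) => n.
apply: le_trans (series_le_fock_normsq n.+1 x).
rewrite /series/= big_nat_recl//= -[leLHS]add0r lerD ?level_normsq_ge0//.
apply: ler_sum => k _; rewrite -lecR !level_normsqE level_innerS.
by rewrite (bigD1 i)//= lerDl; apply: sumr_ge0 => j _; exact: level_inner_ge0.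
Qed.

Lemma adj_creation H i (x : fock d H) w : val (adj (creation i) x) w = val x (i :: w).
Proof.
pose s : fock d H := exist _ (fun w => val x (i :: w)) (shift_summable i x).
suff -> : adj (creation i) x = s by [].
apply: adj_eq => y; rewrite [LHS]/inner [RHS]/inner/= /fock_inner.
have lS k : level_inner k.+1 (val (creation i y)) (val x) =
    level_inner k (val y) (fun w => val x (i :: w)).
  rewrite level_innerS (bigD1 i)//= [X in _ + X]big1 => [|j /negPf ji].
    by rewrite addr0; apply: eq_bigr => v _; rewrite /= eqxx.
  by rewrite /level_inner big1// => v _; rewrite /= ji inner0l.
by congr (_ +i* _)%C; apply: limn_series_shift => [|k];
  rewrite ?lS// level_inner0 inner0l.
Qed.

Lemma adj_creation_creation H i j (x : fock d H) :
  adj (creation i) (creation j x) = if i == j then x else 0.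
Proof.
by apply: fock_ext => w; rewrite adj_creation/=; case: eqP; rewrite ?raddf0.
Qed.

Lemma fock_decomp H (x : fock d H) :
  x = fock_vac d (val x [::]) + \sum_(i < d) creation i (adj (creation i) x).
Proof.
apply: fock_ext => -[|j w]; rewrite fock_valD fock_val_sum /=.
  by rewrite big1 ?addr0.
rewrite add0r (bigD1 j)//= eqxx adj_creation big1 ?addr0// => i.
by rewrite eq_sym => /negPf ->.
Qed.

(** The weak form of I = P_0 + sum_i L_i L_i^*. It replaces sums over all words by a vacuum
    coefficient and d backward shifts. *)
Lemma inner_fock_decomp H (x y : fock d H) : inner x y =
  inner (val x [::]) (val y [::]) +
  \sum_(i < d) inner (adj (creation i) x) (adj (creation i) y).
Proof.
rewrite {1}(fock_decomp x) innerDl inner_fock_vac inner_suml; congr (_ + _).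
by apply: eq_bigr => i _; exact: (adjP (creation i)).
Qed.

Lemma adj_ampliation H K (T : 'B(H, K)) (y : fock d K) :
  adj (ampliation T) y = ampliation (adj T) y.
Proof.
apply: adj_eq => x; rewrite [LHS]/inner [RHS]/inner/= /fock_inner.
have lT k : level_inner k (val (ampliation T x)) (val y) =
    level_inner k (val x) (val (ampliation (adj T) y)).
  by apply: eq_bigr => w _; rewrite /= adjP.
by congr (_ +i* _)%C; congr (limn (series _)); apply/funext => k; rewrite lT.
Qed.

Lemma adj_creation_ampliation H K (T : 'B(H, K)) i (x : fock d H) :
  adj (creation i) (ampliation T x) = ampliation T (adj (creation i) x).
Proof. by apply: fock_ext => w; rewrite adj_creation /= adj_creation. Qed.

Lemma adj_symbol H K (M : 'B(fock d H, fock d K)) x :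
  adj (symbol M) x = val (adj M x) [::].
Proof.
by apply: adj_eq => h; rewrite /symbol/= adjP inner_fock_vac.
Qed.

Section MultiAnalytic.
Variables (H K : hilbertType R) (M : 'B(fock d H, fock d K)).
Hypothesis M_analytic : multi_analytic M.

Lemma adj_multi_analytic i x : adj M (adj (creation i) x) = adj (creation i) (adj M x).
Proof. by apply: adj_eq => y; rewrite -[LHS]adjP /= -M_analytic -adjP (adjP M). Qed.

(** theta^* x is the vacuum coefficient of M^* x, and M^* commutes with each L_i^*. A formula for
    |M^* x|^2 thus becomes one for |theta^* x|^2. *)
Lemma inner_adj_symbol x : inner (adj (symbol M) x) (adj (symbol M) x) =
  inner (adj M x) (adj M x) -
  \sum_(i < d) inner (adj M (adj (creation i) x)) (adj M (adj (creation i) x)).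
Proof.
have := inner_fock_decomp (adj M x) (adj M x); rewrite -(adj_symbol M x) => ->.
set s := \sum_(i < d) _; set t := \sum_(i < d) _.
suff -> : s = t by rewrite addrK.
by apply: eq_bigr => i _; congr inner; exact/esym/adj_multi_analytic.
Qed.

End MultiAnalytic.

Lemma multi_analytic_ext H K (M N : 'B(fock d H, fock d K)) :
  multi_analytic M -> multi_analytic N -> (forall h, symbol M h = symbol N h) ->
  forall x, M x = N x.
Proof.
move=> Ma Na MN x; apply: inner_extl => y; rewrite !adjP; congr inner.
apply: fock_ext => w; elim: w y => [|i w IHw] y.
  by rewrite -!adj_symbol; exact: adj_ext.
by rewrite -!adj_creation -!adj_multi_analytic.
Qed.

Lemma ampliation_multi_analytic H K (T : 'B(H, K)) :
  multi_analytic (@ampliation R d H K T).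
Proof.
move=> i x; apply: fock_ext => -[|j w] /=; first by rewrite linear0.
by case: eqP => // _; rewrite linear0.
Qed.

End FockSpace.

(** * Row contractions and characteristic functions *)

Section RowOperators.
Variables (R : realType) (d : nat).
Implicit Types H K : hilbertType R.

Lemma adj0 H K (y : K) : adj (\0 : 'B(H, K)) y = 0.
Proof. by apply: adj_eq => x; rewrite inner0l inner0r. Qed.

Lemma adj_id H (y : H) : adj (idfun : 'B(H, H)) y = y.
Proof. exact: adj_eq. Qed.

Lemma inner_hsum H K (x y : hsum H K) : inner x y = inner x.1 y.1 + inner x.2 y.2.
Proof. by []. Qed.

Lemma adj_block2 (H1 H2 K1 K2 : hilbertType R) (a : 'B(H1, K1)) (b : 'B(H2, K1))
    (c : 'B(H1, K2)) (e : 'B(H2, K2)) x :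
  adj (block2 a b c e) x =
  hpair (adj a x.1 + adj c x.2) (adj b x.1 + adj e x.2).
Proof.
apply: adj_eq => y; rewrite !inner_hsum/= !innerDl !innerDr !adjP.
by rewrite addrACA.
Qed.

Lemma adj_block2_snd (H1 H2 K1 K2 : hilbertType R) (a : 'B(H1, K1)) (b : 'B(H2, K1))
    (c : 'B(H1, K2)) (e : 'B(H2, K2)) y :
  adj (block2 a b c e) (hpair 0 y) = hpair (adj c y) (adj e y).
Proof. by rewrite adj_block2/= !linear0 !add0r. Qed.

Lemma adj_block2_diag (H1 H2 K1 K2 : hilbertType R) (a : 'B(H1, K1)) (e : 'B(H2, K2)) x y :
  adj (block2 a \0 \0 e) (hpair x y) = hpair (adj a x) (adj e y).
Proof. by rewrite adj_block2/= !adj0 addr0 add0r. Qed.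

Lemma inner_dsum H (x y : dsum d H) :
  inner x y = \sum_(i < d) inner (dcoord x i) (dcoord y i).
Proof. by []. Qed.

Lemma inner_dincl H i (h : H) (z : dsum d H) :
  inner (dincl i h) z = inner h (dcoord z i).
Proof.
rewrite inner_dsum (bigD1 i)//= /dcoord ffunE eqxx big1 ?addr0// => j /negPf ji.
by rewrite ffunE ji inner0l.
Qed.

Lemma dcoord_adj_rowop H K (T : 'I_d -> 'B(H, K)) y i :
  dcoord (adj (rowop T) y) i = adj (T i) y.
Proof.
apply: inner_extr => x; rewrite -inner_dincl -adjP -[RHS]adjP; congr (inner _ y).
rewrite /= /rowop (bigD1 i)//= /dcoord ffunE eqxx big1 ?addr0// => j /negPf ji.
by rewrite ffunE ji linear0.
Qed.

Lemma inner_adj_rowop H K (T : 'I_d -> 'B(H, K)) x y :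
  inner (adj (rowop T) x) (adj (rowop T) y) =
  \sum_(i < d) inner (adj (T i) x) (adj (T i) y).
Proof. by rewrite inner_dsum; apply: eq_bigr => i _; rewrite !dcoord_adj_rowop. Qed.

(** Bessel's inequality: [p] is the projection of [k] onto the sum of the ranges, and |k - p|^2 =
    |k|^2 - s. *)
Lemma row_isometry_bessel H K (T : 'I_d -> 'B(H, K)) :
  (forall i x, adj (T i) (T i x) = x) ->
  (forall i j x, i != j -> adj (T i) (T j x) = 0) ->
  forall k, \sum_(i < d) inner (adj (T i) k) (adj (T i) k) <= inner k k.
Proof.
move=> T1 T0 k; set s := \sum_(i < d) _.
pose p := \sum_(i < d) T i (adj (T i) k).
have pk : inner p k = s.
  by rewrite inner_suml; apply: eq_bigr => i _; rewrite (adjP (T i)).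
have s_conj : s^* = s by apply/CrealP/ger0_real/sumr_ge0 => i _; exact: inner_ge0.
have kp : inner k p = s by rewrite innerC pk.
have pp : inner p p = s.
  rewrite {1}/p inner_suml; apply: eq_bigr => i _; rewrite (adjP (T i)).
  congr inner; rewrite /p raddf_sum (bigD1 i)//= T1 big1 ?addr0// => j ji.
  by rewrite T0// eq_sym.
have := inner_ge0 (k - p).
by rewrite innerBl !innerBr pk kp pp subrr subr0 subr_ge0.
Qed.

Lemma contractiveP H K (T : 'B(H, K)) :
  (forall x, inner (T x) (T x) <= inner x x) -> contractive T.
Proof.
move=> T1 x; rewrite -(@ler_pXn2r _ 2) ?nnegrE// -!inner_norm.
exact: T1.
Qed.

Lemma contractive_of_adj H K (T : 'B(H, K)) : contractive (adj T) -> contractive T.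
Proof. by move=> /adj_contractive T1 x; rewrite -(adjK T). Qed.

Lemma sub_svalP H (S : closedSubspace H) (a : R[i]) (x y : subHilbert S) :
  sval (a *: x + y) = a *: sval x + sval y.
Proof. exact: (linearP (val : subHilbert S -> H)). Qed.

Lemma hpairP H K (a : R[i]) (h h' : H) (k k' : K) :
  hpair (a *: h + h') (a *: k + k') = a *: hpair h k + hpair h' k'.
Proof. by []. Qed.

Lemma ortho_mem H (S : set H) x : (forall y, S y -> inner x y = 0) ->
  x \in csub_mem (Defs.ortho S).
Proof. by move=> xS; apply/csub_memP. Qed.

Lemma sub_svalB H (S : closedSubspace H) (x y : subHilbert S) :
  sval (x - y) = sval x - sval y.
Proof. exact: (raddfB (val : subHilbert S -> H)). Qed.

(** The kernel of a self-adjoint operator is orthogonal to its range. This is what allows D_C to be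
    cancelled in B^* = D_C gamma D_{*,A}. *)
Lemma crange_ker H (T : 'B(H, H)) : (forall x y, inner (T x) y = inner x (T y)) ->
  forall x : subHilbert (crange T), T (sval x) = 0 -> x = 0.
Proof.
move=> Ts x Tx; apply: (@to_crange_total _ _ _ T) => y.
by rewrite sub_inner/= Ts Tx inner0r.
Qed.

Lemma crange_inj H (T : 'B(H, H)) : (forall x y, inner (T x) y = inner x (T y)) ->
  forall x y : subHilbert (crange T), T (sval x) = T (sval y) -> x = y.
Proof.
move=> Ts x y Txy; apply/eqP; rewrite -subr_eq0; apply/eqP/crange_ker => //.
by rewrite sub_svalB linearB/= Txy subrr.
Qed.

Lemma crange_intertwine H K (S : 'B(H, H)) (T : 'B(K, K)) (Z : 'B(H, K)) :
  (forall x, Z (S x) = T (Z x)) ->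
  forall x, x \in csub_mem (crange S) -> Z x \in csub_mem (crange T).
Proof.
move=> ZS x /csub_memP/closure_normP Sx; apply/csub_memP/closure_normP => e e0.
have [M M0 ZM] := op_boundedE Z.
have M1 : 0 < M + 1 by rewrite ltr_wpDl.
have [_ [y _ <-] xy] := Sx _ (divr_gt0 e0 M1).
exists (T (Z y)); first by exists (Z y).
rewrite -ZS -linearB (le_lt_trans (ZM _))//.
rewrite (@le_lt_trans _ _ ((M + 1) * `|x - S y|))//.
  by rewrite ler_wpM2r// lerDl.
by rewrite mulrC -ltr_pdivlMr.
Qed.

End RowOperators.

(** * Poisson kernel and characteristic function of a row contraction *)

Section PoissonKernel.
Variables (R : realType) (d : nat) (H : hilbertType R) (A : 'I_d -> 'B(H, H)).
Hypothesis A1 : contractive (rowop A).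
Local Notation DA := (codefect_space (rowop A)).

Definition poisson_coef (a : H) (w : seq 'I_d) : DA :=
  to_crange (codefect (rowop A)) (adj (word_op A w) a).

(** Adjoints reverse words, so the first letter acts first; this makes [K] intertwine the backward
    shift L_i^* with A_i^*. *)
Lemma poisson_coefS a i w : poisson_coef a (i :: w) = poisson_coef (adj (A i) a) w.
Proof. by rewrite /poisson_coef /= adj_comp. Qed.

Lemma poisson_coef0 a : poisson_coef a [::] = to_crange (codefect (rowop A)) a.
Proof. by rewrite /poisson_coef/= adj_id. Qed.

(** Telescoping: the vacuum term is |a|^2 - sum_i |A_i^* a|^2, and the longer words contribute the
    series of the vectors A_i^* a, which the induction bounds by the subtracted sum. *)
Lemma series_poisson a n :
  series (fun k => level_normsq k (poisson_coef a)) n <= complex.Re (inner a a).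
Proof.
elim: n a => [|n IHn] a.
  by rewrite /series/= big_geq// nsq_ge0.
rewrite /series/= big_nat_recl//=.
have -> : level_normsq 0 (poisson_coef a) =
    complex.Re (inner a a) - \sum_(i < d) complex.Re (inner (adj (A i) a) (adj (A i) a)).
  apply: complexI; rewrite level_normsqE level_inner0 poisson_coef0 sub_inner/=.
  rewrite inner_codefect// inner_adj_rowop rmorphB rmorph_sum/= inner_nsq.
  by congr (_ - _); apply: eq_bigr => i _; rewrite inner_nsq.
rewrite -addrA gerDl addrC subr_le0.
have -> : \sum_(0 <= k < n) level_normsq k.+1 (poisson_coef a) =
    \sum_(i < d) series (fun k => level_normsq k (poisson_coef (adj (A i) a))) n.
  rewrite exchange_big/=; apply: eq_bigr => k _; apply: complexI.
  rewrite level_normsqE level_innerS rmorph_sum; apply: eq_bigr => i _ /=.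
  rewrite level_normsqE; congr level_inner; apply/funext => w;
  exact: poisson_coefS.
by apply: ler_sum => i _; exact: IHn.
Qed.

Lemma poisson_exists : exists K : 'B(H, fock d DA), forall a, val (K a) = poisson_coef a.
Proof.
pose K0 a : fock d DA := exist _ (poisson_coef a) (square_summable_bounded (series_poisson a)).
have [||K KE] := @bounded_op_of R H (fock d DA) K0.
- move=> c a b; apply: fock_ext => w; rewrite fock_valD/= /poisson_coef.
  by rewrite !linearP.
- by exists 1 => a; apply: fock_norm_le => // n; rewrite expr1n mul1r series_poisson.
by exists K => a; rewrite KE.
Qed.

Section Kernel.
Variable K : 'B(H, fock d DA).
Hypothesis KE : forall a, val (K a) = poisson_coef a.

Lemma adj_creation_poisson i a : adj (creation i) (K a) = K (adj (A i) a).
Proof.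
by apply: fock_ext => w; rewrite adj_creation !KE poisson_coefS.
Qed.

Definition poisson_tail (y : fock d DA) : dsum d H :=
  [ffun i => adj K (adj (creation i) y)].

Lemma adj_poisson y : adj K y =
  codefect (rowop A) (sval (val y [::])) + rowop A (poisson_tail y).
Proof.
apply: adj_eq => a; rewrite inner_fock_decomp KE poisson_coef0 sub_inner/=.
rewrite codefect_selfadj innerDr; congr (_ + _).
rewrite -adjPl inner_dsum; apply: eq_bigr => i _.
by rewrite dcoord_adj_rowop adj_creation_poisson (adjP K) [dcoord _ _]ffunE.
Qed.

Variable thA : 'B(defect_space (rowop A), fock d DA).
Hypothesis hthA : is_characteristic_function thA.

Lemma adj_creation_characteristic k x :
  adj (creation k) (thA x) = K (dcoord (defect (rowop A) (sval x)) k).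
Proof.
apply: fock_ext => w; rewrite adj_creation KE.
exact: (hthA x).2.
Qed.

(** With [adj_poisson], this presents K^* y and thA^* y as the two components of the Julia matrix
    [[D_*, A], [-A^*, D]] applied to the vacuum coefficient and the tail of [y]. Its unitarity gives
    the norm identity that follows. *)
Lemma sval_adj_characteristic y : sval (adj thA y) =
  defect (rowop A) (poisson_tail y) - adj (rowop A) (sval (val y [::])).
Proof.
set s := _ - _.
(* A^* D_* = D A^* carries the closed range of D_* into that of D. *)
have sD : s \in csub_mem (crange (defect (rowop A))).
  rewrite rpredB//; first exact: to_crange_subproof.
  apply: crange_intertwine (valP (val y [::])) => x.
  exact: defect_intertwine_adj.
suff -> : adj thA y = (exist _ s sD : defect_space (rowop A)) by [].
apply: adj_eq => x; rewrite inner_fock_decomp !sub_inner/= (hthA x).1.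
rewrite innerBr addrC; congr (_ + _); last first.
  by rewrite -adjP -scaleN1r innerZl mulN1r.
rewrite -defect_selfadj inner_dsum; apply: eq_bigr => i _.
by rewrite adj_creation_characteristic (adjP K) [dcoord (poisson_tail _) _]ffunE.
Qed.

(* The defect identity [I - M_thA M_thA^* = K K^*] compressed to the vacuum. *)
Lemma inner_adj_characteristic y :
  inner (adj thA y) (adj thA y) = inner (val y [::]) (val y [::]) -
    inner (adj K y) (adj K y) +
    \sum_(i < d) inner (adj K (adj (creation i) y)) (adj K (adj (creation i) y)).
Proof.
rewrite [LHS]sub_inner [in LHS]/= sval_adj_characteristic adj_poisson.
rewrite [X in _ = X - _ + _]sub_inner.
have -> : \sum_(i < d) inner (adj K (adj (creation i) y)) (adj K (adj (creation i) y)) =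
    inner (poisson_tail y) (poisson_tail y).
  by apply: eq_bigr => i _; rewrite /dcoord ffunE.
set t := sval (val y [::]); set z := poisson_tail y.
have cross : inner (adj (rowop A) t) (defect (rowop A) z) =
    inner (codefect (rowop A) t) (rowop A z).
  by rewrite adjPl defect_intertwine// -codefect_selfadj.
have cross' : inner (defect (rowop A) z) (adj (rowop A) t) =
    inner (rowop A z) (codefect (rowop A) t).
  by rewrite innerC cross -innerC.
rewrite innerBl !innerBr innerDl !innerDr cross cross'.
rewrite inner_defect// inner_codefect//.
ring.
Qed.

End Kernel.

End PoissonKernel.

(** * The lifting associated to a symbol *)

Section AssociatedLifting.
Variables (R : realType) (d : nat) (HC : hilbertType R) (C : 'I_d -> 'B(HC, HC)).
Local Notation DC := (defect_space (rowop C)).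
Variables (D : hilbertType R) (M : 'B(fock d D, fock d DC)).
Hypotheses (M_analytic : multi_analytic M) (M1 : contractive M).
Variables (B : 'I_d -> 'B(HC, lifting_space M)).
Variables (A : 'I_d -> 'B(lifting_space M, lifting_space M)).

Lemma lifting_orthogonal (a : lifting_space M) f :
  inner (sval a).1 (M f) + inner (sval a).2 (to_crange (defect M) f) = 0.
Proof.
have /csub_memP aP := valP a.
have := aP (hpair (M f) (to_crange (defect M) f)) (ex_intro _ f erefl).
by rewrite inner_hsum.
Qed.

Section Shifts.
Variable Y : 'I_d -> 'B(defect_space M, defect_space M).
Hypothesis Y_isometric : forall i, isometric (Y i).
Hypothesis YE : forall i f, Y i (to_crange (defect M) f) =
  to_crange (defect M) (creation i f).
Hypothesis embedE : forall i x,
  lifting_embed (adj (block2 (C i) \0 (B i) (A i)) x) =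
  adj (block2 (isometric_dilation C i) \0 \0 (Y i)) (lifting_embed x).

(** The defining relation of the lifting at [0 (+) a]; its three components give B_i^* and both
    halves of A_i^*. *)
Let embed_adj i (a : lifting_space M) :
  hpair (hpair (adj (B i) a) (sval (adj (A i) a)).1) (sval (adj (A i) a)).2 =
  hpair (hpair (adj (@fock_vac R d DC \o (to_crange (defect (rowop C)) \o @dincl R d HC i))
      (sval a).1) (adj (creation i) (sval a).1)) (adj (Y i) (sval a).2).
Proof.
have := embedE i (hpair 0 a).
rewrite (adj_block2_snd (C i)) /lifting_embed adj_block2_diag.
by rewrite [isometric_dilation C i]/(isometric_dilation _ _) adj_block2_snd.
Qed.

Lemma adj_A1 i a : (sval (adj (A i) a)).1 = adj (creation i) (sval a).1.
Proof. by case: (embed_adj i a). Qed.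

Lemma adj_A2 i a : (sval (adj (A i) a)).2 = adj (Y i) (sval a).2.
Proof. by case: (embed_adj i a). Qed.

Lemma adj_rowB a : adj (rowop B) a = defect (rowop C) (sval (val (sval a).1 [::])).
Proof.
apply/ffunP => i; rewrite -!/(dcoord _ _) dcoord_adj_rowop.
case: (embed_adj i a) => -> _ _; apply: adj_eq => h /=.
by rewrite inner_fock_vac sub_inner/= defect_selfadj inner_dincl.
Qed.

Lemma adj_Y_Y i x : adj (Y i) (Y i x) = x.
Proof.
apply: adj_eq => y; apply: polarization => z.
by rewrite !inner_norm Y_isometric.
Qed.

(** On vectors Delta f the inner product is that of [f] minus that of [M f]. Since M commutes with
    the L_i, both terms vanish for distinct letters; density of the range of Delta does the rest. *)
Lemma adj_Y_Y0 i j x : i != j -> adj (Y i) (Y j x) = 0.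
Proof.
move=> ij; have LL f g : inner (creation i f) (creation j g) = 0 :> R[i].
  by rewrite (adjP (creation i)) adj_creation_creation (negPf ij) inner0r.
have YY f g : inner (Y i (to_crange (defect M) f)) (Y j (to_crange (defect M) g)) = 0.
  by rewrite !YE sub_inner/= inner_defect// !M_analytic !LL subrr.
apply: (@to_crange_total _ _ _ (defect M)) => f; rewrite -adjP -adjPl.
rewrite [adj _ _](_ : _ = 0) ?inner0l//.
apply: (@to_crange_total _ _ _ (defect M)) => g.
by rewrite -adjP innerC YY conjC0.
Qed.

(** A_i^* restricts L_i^* (+) Y_i^*, and both families are isometries with orthogonal ranges, so
    Bessel's inequality applies to each component. *)
Lemma lifting_row_contractive : contractive (rowop A).
Proof.
apply/contractive_of_adj/contractiveP => a; rewrite inner_adj_rowop.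
under eq_bigr => i _ do rewrite sub_inner inner_hsum [(val _).1]adj_A1 [(val _).2]adj_A2.
rewrite big_split sub_inner inner_hsum/= lerD//.
  by rewrite [leRHS]inner_fock_decomp lerDr inner_ge0.
by apply: row_isometry_bessel => [i x|i j x]; [exact: adj_Y_Y|exact: adj_Y_Y0].
Qed.

Section Gamma.
Variable gamma : 'B(codefect_space (rowop A), DC).
Hypothesis hgamma : lifting_contraction B gamma.

(** The corner of the dilation lands in e_0 (x) D_C, so B^* reads only the vacuum coefficient of the
    first component, through D_C. Comparing with B^* = D_C gamma D_{*,A} and cancelling D_C gives
    [gamma]. *)
Lemma gamma_codefect a :
  gamma (to_crange (codefect (rowop A)) a) = val (sval a).1 [::].
Proof.
apply: crange_inj; first exact: defect_selfadj.
by rewrite -adj_rowB hgamma.2.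
Qed.

Variable K : 'B(lifting_space M, fock d (codefect_space (rowop A))).
Hypothesis KE : forall a, val (K a) = poisson_coef A a.

(** Both sides agree at the vacuum and turn L_i^* into A_i^*, so induction on words settles every
    coefficient. *)
Lemma ampliation_gamma_poisson a : ampliation gamma (K a) = (sval a).1.
Proof.
apply: fock_ext => w; elim: w a => [|i w IHw] a.
  by rewrite /= [sval (K a) _](congr1 (fun f => f [::]) (KE a)) poisson_coef0 gamma_codefect.
rewrite -!adj_creation adj_creation_ampliation (adj_creation_poisson KE).
by rewrite IHw adj_A1.
Qed.

(* The adjoint of [a |-> a.1] sends [x] to [(x - M M^* x, - Delta M^* x)]. *)
Lemma inner_adj_M x :
  let y := adj (ampliation gamma) x in
  inner (adj M x) (adj M x) = inner x x - inner (adj K y) (adj K y).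
Proof.
move=> y; pose Delta := to_crange (defect M).
pose z := hpair (x - M (adj M x)) (- Delta (adj M x)).
have zS : z \in csub_mem (Defs.ortho [set z : hsum (fock d DC) (defect_space M) |
    exists f, z = hpair (M f) (to_crange (defect M) f)]%classic).
  apply: ortho_mem => _ [f ->]; rewrite inner_hsum/= innerBl.
  rewrite innerNl sub_inner/= inner_defect//.
  by rewrite (adjPl M) opprB addrA subrK subrr.
pose z' : lifting_space M := exist _ z zS.
have J b : inner b z' = inner (sval b).1 x.
  rewrite sub_inner inner_hsum/= innerBr innerNr.
  rewrite -addrA -opprD [X in _ - X](_ : _ = 0) ?subr0//.
  exact: lifting_orthogonal.
have -> : adj K y = z'.
  apply: adj_eq => a; transitivity (inner (ampliation gamma (K a)) x).
    exact/esym/adjP.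
  by rewrite ampliation_gamma_poisson J.
by rewrite J/= innerBl (adjP M) subKr.
Qed.

(** The terms |K^* y|^2 and |K^* L_i^* y|^2 occur alike in [inner_adj_M] and in
    [inner_adj_characteristic] and cancel; what is left depends only on [gamma] and theta_A. *)
Lemma inner_adj_symbol_lifting (thA : 'B(defect_space (rowop A),
    fock d (codefect_space (rowop A)))) : is_characteristic_function thA ->
  forall x, let y := adj (ampliation gamma) x in
  inner (adj (symbol M) x) (adj (symbol M) x) =
  inner (val x [::]) (val x [::]) - inner (val y [::]) (val y [::]) +
  inner (adj thA y) (adj thA y).
Proof.
move=> hthA x y; rewrite inner_adj_symbol// inner_adj_M.
rewrite (inner_adj_characteristic lifting_row_contractive KE hthA) -/y.
have yE i : adj (ampliation gamma) (adj (creation i) x) = adj (creation i) y.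
  exact: (adj_multi_analytic (@ampliation_multi_analytic _ d _ _ gamma)).
have -> : \sum_(i < d) inner (adj M (adj (creation i) x)) (adj M (adj (creation i) x)) =
  \sum_(i < d) inner (adj (creation i) x) (adj (creation i) x) -
  \sum_(i < d) inner (adj K (adj (creation i) y)) (adj K (adj (creation i) y)).
  rewrite -sumrB; apply: eq_bigr => i _; rewrite inner_adj_M.
  by rewrite yE.
rewrite (inner_fock_decomp x x).
move: (\sum_(i < d) _) (\sum_(i < d) _) (inner _ _) (inner _ _) (inner _ _) => a b c e f.
ring.
Qed.

End Gamma.
End Shifts.
End AssociatedLifting.

(** * Equivalence *)

Section SymbolEquivalence.
Variables (R : realType) (d : nat).
Implicit Types H K : hilbertType R.

(** Polarised, the hypothesis reads th1 th1^* = th2 th2^*, which is th1 = th2 v on the dense range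
    of th1^*. *)
Lemma equivalent_symbols_of_adj H1 H2 K (th1 : 'B(H1, fock d K)) (th2 : 'B(H2, fock d K)) :
  injective th1 -> injective th2 ->
  (forall x, inner (adj th1 x) (adj th1 x) = inner (adj th2 x) (adj th2 x)) ->
  equivalent_symbols th1 th2.
Proof.
move=> i1 i2 th12.
have [v vU vE] := isometric_extension th12 (injective_adj_total i1) (injective_adj_total i2).
exists v => // h; apply: (total_range_ext (T := th2 \o v) (injective_adj_total i1)) => x /=.
rewrite vE; apply: inner_extl => y.
by rewrite [LHS]adjP [RHS]adjP; exact: polarization.
Qed.

Lemma fock_vac_ampliation H K (T : 'B(H, K)) h :
  ampliation T (fock_vac d h) = fock_vac d (T h).
Proof. by apply: fock_ext => -[|i w] //=; rewrite linear0. Qed.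

Lemma ampliation_unitary H K (U : 'B(H, K)) :
  unitary U -> unitary (@ampliation R d H K U).
Proof.
move=> [U1 U2]; split=> x; rewrite adj_ampliation; apply: fock_ext => w /=.
  by rewrite U1.
by rewrite U2.
Qed.

Lemma multi_analytic_comp H K L (M : 'B(fock d K, fock d L)) (N : 'B(fock d H, fock d K)) :
  multi_analytic M -> multi_analytic N -> multi_analytic (M \o N).
Proof. by move=> Ma Na i x /=; rewrite Na Ma. Qed.

Lemma total_range_comp H (G G' : Type) (f : G -> H) (s : G' -> G) (t : G -> G') :
  cancel t s -> total_range f -> total_range (f \o s).
Proof. by move=> ts tf h h0; apply: tf => x; rewrite -(ts x); exact: h0. Qed.

Lemma unitary_adj_intertwine H K (W : 'B(H, K)) (Y : 'B(H, H)) (Y' : 'B(K, K)) :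
  unitary W -> (forall x, Y' (W x) = W (Y x)) -> forall x, adj Y' (W x) = W (adj Y x).
Proof.
move=> WU YW x; apply: adj_eq => z; rewrite -{1}(WU.2 z) YW unitary_inner//.
by rewrite adjP -[RHS]adjPl.
Qed.

Lemma adj_unitary_intertwine H H' K K' (S : 'B(H, K)) (S' : 'B(H', K'))
    (U : 'B(H', H)) (T : 'B(K', K)) :
  unitary T -> (forall x, S (U x) = T (S' x)) ->
  forall y, adj U (adj S (T y)) = adj S' y.
Proof.
move=> TU SU y; apply/esym/adj_eq => x.
by rewrite -[RHS]adjP -[RHS]adjP SU unitary_inner.
Qed.

Lemma dsum_map H K (T : 'B(H, K)) : exists F : 'B(dsum d H, dsum d K),
  forall z i, dcoord (F z) i = T (dcoord z i).
Proof.
pose F0 (z : dsum d H) : dsum d K := [ffun i => T (dcoord z i)].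
have [||F FE] := @bounded_op_of R (dsum d H) (dsum d K) F0.
- by move=> a x y; apply/ffunP => i; rewrite !ffunE /dcoord !ffunE linearP.
- have [M M0 TM] := op_boundedE T; exists M => x.
  rewrite -(@ler_pXn2r _ 2) ?nnegrE ?mulr_ge0// exprMn -!inner_norm !inner_dsum mulr_sumr.
  apply: ler_sum => i _; rewrite !inner_norm -exprMn lerXn2r ?nnegrE ?mulr_ge0//.
  by rewrite [dcoord _ _]ffunE.
by exists F => z i; rewrite FE [dcoord _ _]ffunE.
Qed.

End SymbolEquivalence.

Section CharacteristicValues.
Variables (R : realType) (d : nat) (H : hilbertType R) (T : 'I_d -> 'B(H, H)).
Hypothesis T1 : contractive (rowop T).
Variable th : 'B(defect_space (rowop T), fock d (codefect_space (rowop T))).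
Hypothesis hth : is_characteristic_function th.

Lemma characteristic_vacuum z : val (th (to_crange (defect (rowop T)) z)) [::] =
  - to_crange (codefect (rowop T)) (rowop T z).
Proof.
apply: val_inj; rewrite raddfN; rewrite [LHS](hth _).1.
by rewrite defect_intertwine.
Qed.

Lemma characteristic_word z k w : val (th (to_crange (defect (rowop T)) z)) (k :: w) =
  to_crange (codefect (rowop T)) (adj (word_op T w)
    (dcoord z k - adj (T k) (rowop T z))).
Proof.
rewrite [LHS](hth _).2; congr (to_crange _ (adj _ _)).
by rewrite defectK// -dcoord_adj_rowop /dcoord !ffunE.
Qed.

End CharacteristicValues.

(** * Characteristic functions of unitarily equivalent row contractions *)

Section UnitaryEquivalence.
Variables (R : realType) (d : nat) (H H' : hilbertType R).
Variables (A : 'I_d -> 'B(H, H)) (A' : 'I_d -> 'B(H', H')) (u : 'B(H', H)).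
Hypotheses (A1 : contractive (rowop A)) (A1' : contractive (rowop A')).
Hypotheses (uU : unitary u) (uA : forall i x, u (adj (A' i) x) = adj (A i) (u x)).
Variable thA : 'B(defect_space (rowop A), fock d (codefect_space (rowop A))).
Variable thA' : 'B(defect_space (rowop A'), fock d (codefect_space (rowop A'))).
Hypotheses (hthA : is_characteristic_function thA).
Hypotheses (hthA' : is_characteristic_function thA').

Let Au i x : A i (u x) = u (A' i x).
Proof.
apply: inner_extl => a; rewrite adjP [RHS]adjP (adjP (A' i)).
rewrite (adjP u); congr inner; rewrite -[in LHS](uU.2 a) -uA.
exact: uU.1.
Qed.

Lemma adj_word_op_equiv w x : adj (word_op A w) (u x) = u (adj (word_op A' w) x).
Proof.
elim: w x => [|i w IHw] x /=; first by rewrite !adj_id.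
by rewrite !adj_comp -uA IHw.
Qed.

(** U sends D_{A'} z to D_A F z, with [F] acting as [u] in each coordinate. On vectors D_A z the
    square D_A^2 = I - A^* A removes the inner root from theta_A, so only the intertwining of A with
    A' is used. *)
Lemma unitary_equivalence : exists (U : 'B(defect_space (rowop A'), defect_space (rowop A)))
    (Ut : 'B(codefect_space (rowop A'), codefect_space (rowop A))),
  [/\ unitary U, unitary Ut,
    forall a, Ut (to_crange (codefect (rowop A')) a) = to_crange (codefect (rowop A)) (u a) &
    forall x, thA (U x) = ampliation Ut (thA' x)].
Proof.
have [F FE] := dsum_map d u; have [G GE] := dsum_map d (adj u).
have FG : cancel G F.
  by move=> z; apply/ffunP => i; rewrite -!/(dcoord _ _) FE GE uU.2.
have FF x y : inner (F x) (F y) = inner x y.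
  by rewrite !inner_dsum; apply: eq_bigr => i _; rewrite !FE unitary_inner.
have AF z : rowop A (F z) = u (rowop A' z).
  by rewrite /rowop raddf_sum; apply: eq_bigr => i _; rewrite FE Au.
have [|U UU UE] := @isometric_extension R _ _ _ (to_crange (defect (rowop A')))
    (to_crange (defect (rowop A)) \o F) _ (@to_crange_total _ _ _ _)
    (total_range_comp FG (@to_crange_total _ _ _ _)).
  by move=> z; rewrite !sub_inner/= !inner_defect// FF/= AF unitary_inner.
have [|Ut UtU UtE] := @isometric_extension R _ _ _ (to_crange (codefect (rowop A')))
    (to_crange (codefect (rowop A)) \o u) _ (@to_crange_total _ _ _ _)
    (total_range_comp uU.2 (@to_crange_total _ _ _ _)).
  move=> a; rewrite !sub_inner/= !inner_codefect// !inner_adj_rowop unitary_inner//.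
  congr (_ - _); apply: eq_bigr => i _; rewrite /=.
  by rewrite -(unitary_inner uU) uA.
exists U, Ut; split => //.
apply: (total_range_ext (S := thA \o U) (T := @ampliation _ d _ _ Ut \o thA')
  (@to_crange_total _ _ _ (defect (rowop A')))) => z.
apply: fock_ext => -[|k w] /=; rewrite UE/=.
  rewrite (characteristic_vacuum A1 hthA) [sval (thA' _) _](characteristic_vacuum A1' hthA').
  by rewrite linearN/= UtE/= AF.
rewrite (characteristic_word A1 hthA) [sval (thA' _) _](characteristic_word A1' hthA').
by rewrite UtE/= -adj_word_op_equiv (raddfB u)/= AF FE uA.
Qed.

End UnitaryEquivalence.

(** * Liftings associated to equivalent symbols *)

Section LiftingEquivalence.
Variables (R : realType) (d : nat) (HC : hilbertType R) (C : 'I_d -> 'B(HC, HC)).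
Local Notation DC := (defect_space (rowop C)).

(** The two conditions say that the adjoint of I (+) W maps the graph removed for M' into the one
    removed for M, so I (+) W maps the orthogonal complements the other way. It is applied to W and
    to its adjoint, giving a map and its inverse. *)
Lemma lifting_map (D D' : hilbertType R) (M : 'B(fock d D, fock d DC))
    (M' : 'B(fock d D', fock d DC)) (W : 'B(defect_space M, defect_space M'))
    (T : fock d D' -> fock d D) :
  (forall g, M' g = M (T g)) ->
  (forall g, adj W (to_crange (defect M') g) = to_crange (defect M) (T g)) ->
  exists w : 'B(lifting_space M, lifting_space M'),
    forall a, sval (w a) = hpair (sval a).1 (W (sval a).2).
Proof.
move=> MT WT.
have w_mem (a : lifting_space M) : hpair (sval a).1 (W (sval a).2) \in
    csub_mem (Defs.ortho [set z : hsum (fock d DC) (defect_space M') |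
      exists f, z = hpair (M' f) (to_crange (defect M') f)]%classic).
  apply: ortho_mem => _ [g ->]; rewrite inner_hsum/= adjP WT MT.
  exact: lifting_orthogonal.
pose w0 (a : lifting_space M) : lifting_space M' := 
  exist _ (hpair (sval a).1 (W (sval a).2)) (w_mem a).
have w0_linear : linear w0.
  move=> c a b; apply: val_inj; rewrite [RHS]sub_svalP -hpairP -(linearP W).
  by rewrite [LHS]/(hpair _ _) sub_svalP.
have w0_bounded : exists N : R[i], forall a, `|w0 a| <= N * `|a|.
  have [N N0 WN] := op_boundedE W; exists (1 + N) => a.
  rewrite !sub_norm/= (le_trans (hpair_le _ _))// mulrDl mul1r.
  by rewrite lerD ?fst_le// (le_trans (WN _))// ler_wpM2l// snd_le.
have [w wE] := bounded_op_of w0_linear w0_bounded.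
by exists w => a; rewrite wE.
Qed.

Variables (D D' : hilbertType R).
Variables (M : 'B(fock d D, fock d DC)) (M' : 'B(fock d D', fock d DC)).
Hypotheses (M_analytic : multi_analytic M) (M'_analytic : multi_analytic M').
Hypotheses (M1 : contractive M) (M1' : contractive M').
Variable v : 'B(D, D').
Hypotheses (vU : unitary v) (symbolE : forall h, symbol M h = symbol M' (v h)).
Let V := @ampliation R d D D' v.

Let VU : unitary V.
Proof. exact: ampliation_unitary. Qed.

Let ME f : M f = M' (V f).
Proof.
apply: (multi_analytic_ext M_analytic (N := M' \o V)).
  exact: multi_analytic_comp M'_analytic (@ampliation_multi_analytic _ _ _ _ _).
by move=> h; rewrite symbolE /symbol/= fock_vac_ampliation.
Qed.

Lemma defect_space_unitary : exists2 W : 'B(defect_space M, defect_space M'),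
  unitary W & forall f, W (to_crange (defect M) f) = to_crange (defect M') (V f).
Proof.
have VK : cancel (adj V) V := VU.2.
apply: (@isometric_extension R _ _ _ (to_crange (defect M))
  (to_crange (defect M') \o V) _ (@to_crange_total _ _ _ _)
  (total_range_comp VK (@to_crange_total _ _ _ _))).
by move=> f; rewrite !sub_inner/= !inner_defect//= (unitary_inner VU) -ME.
Qed.

Variables (B : 'I_d -> 'B(HC, lifting_space M)).
Variables (A : 'I_d -> 'B(lifting_space M, lifting_space M)).
Variables (B' : 'I_d -> 'B(HC, lifting_space M')).
Variables (A' : 'I_d -> 'B(lifting_space M', lifting_space M')).
Hypotheses (hE : associated_lifting B A) (hE' : associated_lifting B' A').

Lemma lifting_unitary : exists w : 'B(lifting_space M, lifting_space M'),
  [/\ unitary w, forall a, (sval (w a)).1 = (sval a).1 &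
      forall i a, adj (A' i) (w a) = w (adj (A i) a)].
Proof.
have [W WU WE] := defect_space_unitary.
have VK g : V (adj V g) = g := VU.2 g.
have [g|g|w wE] := @lifting_map D D' M M' W (adj V).
- by rewrite -{1}(VK g) -ME.
- by rewrite -{1}(VK g) -WE WU.1.
have [f|f|w' wE'] := @lifting_map D' D M' M (adj W) V.
- exact: ME.
- by rewrite adjK WE.
have ww b : w (w' b) = b.
  by apply: val_inj; rewrite [LHS]wE wE'/= WU.2; case: (sval b).
have w'w a : w' (w a) = a.
  by apply: val_inj; rewrite [LHS]wE' wE/= WU.1; case: (sval a).
have adjw b : adj w b = w' b.
  by apply: adj_eq => a; rewrite [LHS]sub_inner [RHS]sub_inner
    [val (w a)]wE [val (w' b)]wE' !inner_hsum/= adjP.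
have [Y [hY embY]] := hE; have [Y' [hY' embY']] := hE'.
have Y_iso i : isometric (Y i) := (hY i).1.
(* On vectors Delta f this is the commutation of I (x) v with the creation operators. *)
have YW i x : Y' i (W x) = W (Y i x).
  apply: (total_range_ext (S := Y' i \o W) (T := W \o Y i)
    (@to_crange_total _ _ _ (defect M))) => f /=.
  rewrite (hY i).2 !WE (hY' i).2; congr to_crange.
  exact/esym/(@ampliation_multi_analytic _ _ _ _ v).
exists w; split=> [|a|i a]; [by split=> x; rewrite adjw|by rewrite wE|].
have e1 : (sval (adj (A' i) (w a))).1 = (sval (adj (A i) a)).1.
  by rewrite (adj_A1 embY') (adj_A1 embY) wE.
have e2 : (sval (adj (A' i) (w a))).2 = W (sval (adj (A i) a)).2.
  rewrite (adj_A2 embY') (adj_A2 embY) wE.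
  exact: (unitary_adj_intertwine WU (YW i)).
by apply: val_inj; rewrite [RHS]wE -e1 -e2 [LHS]surjective_pairing.
Qed.

End LiftingEquivalence.

Theorem proposition6p6 (R : realType) (d : nat)
    (HC : hilbertType R) (C : 'I_d -> 'B(HC, HC))
    (hC : row_contraction C)
    (D M : hilbertType R)
    (Mth : 'B(fock d D, fock d (defect_space (rowop C))))
    (Mth' : 'B(fock d M, fock d (defect_space (rowop C))))
    (Mth_analytic : multi_analytic Mth)
    (Mth'_analytic : multi_analytic Mth')
    (Mth_contractive : contractive Mth)
    (Mth'_contractive : contractive Mth')
    (th_inj : injective (symbol Mth))
    (th'_inj : injective (symbol Mth'))
    (B : 'I_d -> 'B(HC, lifting_space Mth))
    (A : 'I_d -> 'B(lifting_space Mth, lifting_space Mth))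
    (B' : 'I_d -> 'B(HC, lifting_space Mth'))
    (A' : 'I_d -> 'B(lifting_space Mth', lifting_space Mth'))
    (hE : associated_lifting B A)
    (hE' : associated_lifting B' A')
    (gamma : 'B(codefect_space (rowop A), defect_space (rowop C)))
    (gamma' : 'B(codefect_space (rowop A'), defect_space (rowop C)))
    (hgamma : lifting_contraction B gamma)
    (hgamma' : lifting_contraction B' gamma')
    (thA : 'B(defect_space (rowop A), fock d (codefect_space (rowop A))))
    (thA' : 'B(defect_space (rowop A'), fock d (codefect_space (rowop A'))))
    (hthA : is_characteristic_function thA)
    (hthA' : is_characteristic_function thA') :
  equivalent_symbols (symbol Mth) (symbol Mth') <->
  exists (U : 'B(defect_space (rowop A'), defect_space (rowop A)))
         (Ut : 'B(codefect_space (rowop A'), codefect_space (rowop A))),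
    [/\ unitary U, unitary Ut,
        forall x, gamma x = gamma' (adj Ut x) &
        forall x, thA (U x) = ampliation Ut (thA' x)].
Proof.
have [Y [hY embY]] := hE; have [Y' [hY' embY']] := hE'.
have Y_iso i := (hY i).1; have YE i := (hY i).2.
have Y'_iso i := (hY' i).1; have YE' i := (hY' i).2.
have A1 : contractive (rowop A) :=
  lifting_row_contractive Mth_analytic Mth_contractive Y_iso YE embY.
have A1' : contractive (rowop A') :=
  lifting_row_contractive Mth'_analytic Mth'_contractive Y'_iso YE' embY'.
split=> [[v vU vE]|[U [Ut [UU UtU gammaE thAE]]]].
  have [w [wU w1 wA]] := lifting_unitary Mth_analytic Mth'_analytic Mth_contractive
    Mth'_contractive vU vE hE hE'.
  (* U and Ut go from the primed side to the unprimed one, hence the adjoint of [w]. *)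
  have uA i x : adj w (adj (A' i) x) = adj (A i) (adj w x).
    by rewrite -{1}(wU.2 x) wA wU.1.
  have [U [Ut [UU UtU UtE thE]]] := unitary_equivalence A1 A1' (unitary_adj wU) uA hthA hthA'.
  exists U, Ut; split=> // x.
  apply: (total_range_ext (S := gamma) (T := gamma' \o adj Ut)
    (@to_crange_total _ _ _ (codefect (rowop A)))) => a.
  (* On D_{*,A} a both sides are vacuum coefficients, of [a] and of [w a]; these agree because [w]
     fixes the first component. *)
  rewrite (gamma_codefect embY hgamma) -{2}(wU.1 a) -UtE [RHS]/= UtU.1.
  by rewrite (gamma_codefect embY' hgamma') w1.
have [K KE] := poisson_exists A1; have [K' KE'] := poisson_exists A1'.
apply: equivalent_symbols_of_adj => // x.
rewrite (inner_adj_symbol_lifting Mth_analytic Mth_contractive Y_iso YE embY hgamma KE hthA).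
rewrite (inner_adj_symbol_lifting Mth'_analytic Mth'_contractive Y'_iso YE' embY'
  hgamma' KE' hthA').
set y := adj (ampliation gamma) x; set y' := adj (ampliation gamma') x.
(* The adjoint of gamma = gamma' Ut^*; it gives y = (I (x) Ut) y', so the vacuum coefficients of y
   and y' have equal norms. *)
have gammaE' k : adj gamma k = Ut (adj gamma' k).
  by apply: adj_eq => a; rewrite gammaE adjP adjPl.
have yE : y = ampliation Ut y'.
  by rewrite /y /y' !adj_ampliation; apply: fock_ext => w /=.
have <- : adj U (adj thA y) = adj thA' y'.
  rewrite yE; exact: (adj_unitary_intertwine (ampliation_unitary d UtU) thAE).
rewrite (unitary_inner (unitary_adj UU)); congr (_ - _ + _).
by rewrite yE /= unitary_inner.
Qed.
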